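(* Let $T$ be a bounded linear operator on a complex Hilbert space $\mathcal{H}$ such that $W_s(T)$ has non-empty interior. Assume that $\lambda$ is a point of infinite one-sided curvature of $\partial W_s(T)$, and suppose that there is only one tangent line to $\partial W_s(T)$ at the point $\lambda$. Then $\lambda\in R_e(T)$. If, in addition, $\lambda$ is a point of infinite curvature of $W_s(T)$, then $\lambda$ is a normal essential eigenvalue of $T$.
   Context: The state numerical range is $W_s(T)=\{\phi(T):\phi\in S(C^*(T))\}$, where $C^*(T)$ is the $C^*$-algebra generated by $T$ and the identity $I$, and $S(\mathcal{A})$ is the state space of $\mathcal{A}$. One has $W_s(T)=\overline{W(T)}$, where $W(T)=\{\langle Tx,x\rangle:\|x\|=1\}$; it is compact and convex. Let $C\subset\mathbb{C}$ be convex with non-empty interior. $C$ is in standard position (with respect to the boundary point $0\in\partial C$) if $C$ is contained in the closed upper half-plane $\{\operatorname{Im}\alpha\ge 0\}$. A point $\lambda\in\partial C$ is of infinite curvature if, after a suitable rotation and translation taking $\lambda$ to $0$ and putting $C$ in standard position, $$\lim_{\alpha\to 0,\ \alpha\in C}\frac{|\operatorname{Im}\alpha|}{(\operatorname{Re}\alpha)^2}=\infty .$$ If $C$ is so placed in standard position and the real axis is the only tangent (i.e. supporting) line to $\partial C$ at $0$, then the point is of infinite lefthand curvature if $\frac{|\operatorname{Im}\alpha|}{(\operatorname{Re}\alpha)^2}\to\infty$ as $\alpha\to 0$ with $\alpha\in C$, $\operatorname{Re}\alpha<0$, and of infinite righthand curvature if the same holds with $\operatorname{Re}\alpha>0$.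 It is of infinite one-sided curvature if it is of infinite lefthand or infinite righthand curvature. In these limits $\alpha\ne0$, and the quotient is read as $+\infty$ when $\operatorname{Re}\alpha=0\neq\operatorname{Im}\alpha$. $R_e(T)$ (reducing essential eigenvalues) is the set of $\lambda\in\mathbb{C}$ for which there is a sequence $(u_n)$ of unit vectors tending weakly to zero with $\|(T-\lambda I)u_n\|+\|(T^*-\overline{\lambda}I)u_n\|\to 0$. $\lambda$ is a normal essential eigenvalue of $T$ if $\lambda\in R_e(T)$ and every orthonormal sequence $(u_n)$ with $\|(T-\lambda I)u_n\|\to 0$ also satisfies $\|(T^*-\overline{\lambda}I)u_n\|\to 0$. *)

(* Defs.v *)
From HB Require Import structures.
From mathcomp Require Import all_boot all_order all_algebra sesquilinear.
From mathcomp Require Import complex.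
From mathcomp Require Import all_classical all_reals all_analysis.

Set Implicit Arguments.
Unset Strict Implicit.
Unset Printing Implicit Defensive.

Import Order.TTheory GRing.Theory Num.Theory.
Import numFieldNormedType.Exports.

Local Open Scope classical_set_scope.
Local Open Scope ring_scope.

(* The complex field R[i], packed so that the topology and the norm attached to
   every numFieldType are inferred on it. Norms take values in [cplx R], whose
   order satisfies x <= y iff y - x is a nonnegative real. *)
Definition cplx (R : realType) : numClosedFieldType := R[i]%C.

Section PlaneConvexSets.
Variable R : realType.
Local Notation C := (cplx R).
Implicit Types (S L : set C) (z p u : C).

Definition re z : R := complex.Re z.
Definition im z : R := complex.Im z.

Definition boundary S : set C := closure S `\` interior S.

(* The line p + R u, with S on its left; the right side is the case of -u. *)
Definition supporting_line S p L :=
  exists u, [/\ `|u| = 1,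
    L = [set p + (t%:C%C : C) * u | t in [set: R]] &
    forall z, S z -> 0 <= im ((z - p) * u^*)].

(* Image of S under the translation taking p to 0 followed by the rotation by
   the unimodular number u. *)
Definition place S p u : set C := [set u * (z - p) | z in S].

Definition standard_position S :=
  boundary S 0 /\ (forall z, S z -> 0 <= im z).

Definition real_axis : set C := [set z | im z = 0].

Definition curvature_quotient z : \bar R :=
  if re z == 0 then +oo%E else (`|im z| / re z ^+ 2)%:E.

(* The punctured neighbourhoods of 0 exclude the point 0, so the value of the
   quotient there is irrelevant. *)
Definition quotient_to_infty S :=
  curvature_quotient z @[z --> within S (0 : C)^'] --> (+oo)%E.

Definition infinite_curvature S p :=
  exists u, [/\ `|u| = 1, standard_position (place S p u) &
                quotient_to_infty (place S p u)].

Definition infinite_lefthand_curvature S :=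
  quotient_to_infty (S `&` [set z | re z < 0]).

Definition infinite_righthand_curvature S :=
  quotient_to_infty (S `&` [set z | 0 < re z]).

Definition infinite_one_sided_curvature S p :=
  exists u, let S' := place S p u in
  [/\ `|u| = 1, standard_position S',
      (forall L, supporting_line S' 0 L <-> L = real_axis) &
      infinite_lefthand_curvature S' \/ infinite_righthand_curvature S'].

End PlaneConvexSets.

Section Operators.
Variables (R : realType) (H : completeNormedModType (cplx R)).
Local Notation C := (cplx R).
Variable dot : {dot H for Num.conj}.
Implicit Types (T f g : H -> H) (A : set (H -> H)) (lambda : C) (u : nat -> H).

Definition bounded_operator T :=
  linear T /\ exists M : C, forall x, `|T x| <= M * `|x|.

(* For bounded T, and [dot] inducing the norm of H, the vector z below exists
   by the Riesz representation theorem and is unique; the default value 0 is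
   used only for other T. *)
Definition adjoint T : H -> H :=
  fun y => xget 0 [set z | forall x, dot (T x) y = dot x z].

(* Norm-closed unital *-subalgebras of B(H). The product is composition; the
   sum and the scaling are the pointwise ones on H -> H. *)
Record cstar_subalgebra A : Prop := CstarSubalgebra {
  csa_bounded : forall f, A f -> bounded_operator f ;
  csa_id : A idfun ;
  csa_add : forall f g, A f -> A g -> A (f + g) ;
  csa_scale : forall (a : C) f, A f -> A (a *: f) ;
  csa_comp : forall f g, A f -> A g -> A (f \o g) ;
  csa_adjoint : forall f, A f -> A (adjoint f) ;
  csa_closed : forall f, bounded_operator f ->
    (forall e : C, 0 < e ->
      exists2 g, A g & forall x, `|f x - g x| <= e * `|x|) -> A f
}.

Definition cstar_generated T : set (H -> H) :=
  [set f | forall A, cstar_subalgebra A -> A T -> A f].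

(* Only the restriction of phi to A is relevant. *)
Record state A (phi : (H -> H) -> C) : Prop := State {
  state_linear : forall (a : C) f g, A f -> A g ->
    phi (a *: f + g) = a * phi f + phi g ;
  state_pos : forall f, A f -> 0 <= phi (adjoint f \o f) ;
  state_id : phi idfun = 1
}.

Definition state_numerical_range T : set C :=
  [set phi T | phi in state (cstar_generated T)].

Definition weakly_to_zero u :=
  forall y : H, dot (u n) y @[n --> \oo] --> (0 : C).

Definition reducing_essential_eigenvalue T lambda :=
  exists u, [/\ forall n, `|u n| = 1, weakly_to_zero u &
    `|T (u n) - lambda *: u n| + `|adjoint T (u n) - lambda^* *: u n|
      @[n --> \oo] --> (0 : C)].

Definition orthonormal_sequence u :=
  forall i j : nat, dot (u i) (u j) = (i == j)%:R.

Definition normal_essential_eigenvalue T lambda :=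
  reducing_essential_eigenvalue T lambda /\
  forall u, orthonormal_sequence u ->
    `|T (u n) - lambda *: u n| @[n --> \oo] --> (0 : C) ->
    `|adjoint T (u n) - lambda^* *: u n| @[n --> \oo] --> (0 : C).

End Operators.

(* Main.v *)
Require Import Defs.
From mathcomp Require Import all_boot all_order all_algebra sesquilinear.
From mathcomp Require Import complex.
From mathcomp Require Import all_classical all_reals all_analysis.
From mathcomp Require Import ring lra.
Set Implicit Arguments.
Unset Strict Implicit.
Unset Printing Implicit Defensive.

Import Order.TTheory GRing.Theory Num.Theory.
Import numFieldNormedType.Exports.
Local Open Scope classical_set_scope.
Local Open Scope ring_scope.

(** After the rotation and translation of the definition, T becomes
    S = u (T - lambda) = A + i B with A and B symmetric and B >= 0, since the
    numerical range W' of S lies in the upper half-plane. By [state_positive_op]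
    states are positive on positive operators, so lower bounds for the forms of
    S over unit vectors hold for all of W'.

    Suppose the curvature is infinite on the right. The tangent being unique,
    no line im z = s re z with s > 0 supports W', so there are unit vectors x with
    (B x, x) < s (A x, x). By convexity of W', infinite curvature forces
    (A x, x) -> 0 as s -> 0: otherwise the segment from 0 to such a value would be
    too flat near 0 ([small_slope_small]). Now (S x, x) -> 0 gives B x -> 0 by
    Cauchy--Schwarz for the form of B, and A x -> 0 by perturbing x to x + t A x
    with t > 0: the real part of the form grows like t |A x|^2, its imaginary part
    only like t^2, which infinite curvature excludes unless A x is small
    ([curvature_forces_small]). Hence S x -> 0 and S^* x -> 0.

    The vectors x are made weakly null by projecting them first to the closure of
    the sum of the ranges of A and B. This discards a vector annihilated by A and B,
    so it alters none of the forms, and on that closure A x -> 0 and B x -> 0 imply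
    weak convergence to 0 ([weakly_null]). For lefthand curvature A is replaced
    by -A.

    For the normality statement, if S x -> 0 along unit vectors then
    (B x, x) -> 0, hence B x -> 0 as B >= 0, and S^* x = S x - 2 i B x -> 0.

    The Hilbert space theory behind this is the projection theorem, which yields
    the Riesz representation and thereby adjoints, and the square root of a
    positive operator as the limit of Y |-> (S + Y^2) / 2, which stays in the
    C*-algebra generated by T. *)

(** * Real and complex scalars *)

Lemma limit_le0 (R : realType) (c d : R) : (forall e, 0 < e -> c <= d * e) -> c <= 0.
Proof.
move=> h; rewrite leNgt; apply/negP => c0.
have d0 : 0 < `|d| + 1 by rewrite ltr_wpDl.
have e0 : 0 < c / (2 * (`|d| + 1)) by rewrite divr_gt0 // mulr_gt0.
have := h _ e0; apply/negP; rewrite -ltNge.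
apply: (@le_lt_trans _ _ ((`|d| + 1) * (c / (2 * (`|d| + 1))))).
  by rewrite ler_wpM2r ?(ltW e0) //; have := ler_norm d; lra.
rewrite [X in X < _](_ : _ = c / 2); first lra.
by field; rewrite gt_eqF.
Qed.

Lemma inv_small (R : realType) (e : R) : 0 < e ->
  exists N, forall n, (N <= n)%N -> n.+1%:R^-1 <= e.
Proof.
move=> e0; exists (Num.bound e^-1) => n Nn.
rewrite -[X in _ <= X]invrK lef_pV2 ?posrE ?invr_gt0 //.
apply: le_trans (ltW (archi_boundP _)) _; first by rewrite invr_ge0 ltW.
by rewrite ler_nat (leq_trans Nn).
Qed.

Lemma geometric_small (R : realType) (r : R) : 0 <= r < 1 -> forall e, 0 < e ->
  exists N, forall n, (N <= n)%N -> r ^+ n <= e.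
Proof.
move=> /andP[r0 r1] e e0.
have /cvgr0Pnorm_le /(_ e e0)[N _ hN] : (r ^+ n @[n --> \oo] --> (0 : R)).
  by apply: cvg_expr; rewrite ger0_norm.
exists N => n Nn; apply: le_trans (ler_norm _) _; exact: hN.
Qed.

Section ComplexScalars.
Variable R : realType.
Local Notation C := (cplx R).
Implicit Types (z w : C) (t : R).

Definition rc t : C := (t%:C)%C.
Definition ci : C := Complex 0 1.

Lemma cplx_eq z w : re z = re w -> im z = im w -> z = w.
Proof. by case: z w => [a b] [c d] /= -> ->. Qed.

Lemma reD z w : re (z + w) = re z + re w. Proof. by case: z w => [a b] [c d]. Qed.
Lemma imD z w : im (z + w) = im z + im w. Proof. by case: z w => [a b] [c d]. Qed.
Lemma reN z : re (- z) = - re z. Proof. by case: z. Qed.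
Lemma imN z : im (- z) = - im z. Proof. by case: z. Qed.
Lemma reM z w : re (z * w) = re z * re w - im z * im w.
Proof. by case: z w => [a b] [c d]. Qed.
Lemma imM z w : im (z * w) = re z * im w + im z * re w.
Proof. by case: z w => [a b] [c d]. Qed.
Lemma re_conj z : re z^* = re z. Proof. by case: z. Qed.
Lemma im_conj z : im z^* = - im z. Proof. by case: z. Qed.
Lemma re_rc t : re (rc t) = t. Proof. by []. Qed.
Lemma im_rc t : im (rc t) = 0. Proof. by []. Qed.
Lemma re0 : re (0 : C) = 0. Proof. by []. Qed.
Lemma im0 : im (0 : C) = 0. Proof. by []. Qed.
Lemma re1 : re (1 : C) = 1. Proof. by []. Qed.
Lemma im1 : im (1 : C) = 0. Proof. by []. Qed.
Lemma re_ci : re ci = 0. Proof. by []. Qed.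
Lemma im_ci : im ci = 1. Proof. by []. Qed.

Definition cE := (reD, imD, reN, imN, reM, imM, re_conj, im_conj, re_rc, im_rc,
  re0, im0, re1, im1, re_ci, im_ci).

Lemma cplx_le z w : (z <= w) = (im w == im z) && (re z <= re w).
Proof. exact: lecE. Qed.
Lemma cplx_lt z w : (z < w) = (im w == im z) && (re z < re w).
Proof. exact: ltcE. Qed.

Lemma rcD s t : rc (s + t) = rc s + rc t.
Proof. by apply: cplx_eq; rewrite !cE ?addr0. Qed.
Lemma rcM s t : rc (s * t) = rc s * rc t.
Proof. by apply: cplx_eq; rewrite !cE; ring. Qed.
Lemma rc0 : rc 0 = 0. Proof. by []. Qed.
Lemma rc1 : rc 1 = 1. Proof. by []. Qed.
Lemma rcN t : rc (- t) = - rc t.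
Proof. by apply: cplx_eq; rewrite !cE ?oppr0. Qed.
Lemma ler_rc s t : (rc s <= rc t) = (s <= t).
Proof. by rewrite cplx_le !cE eqxx. Qed.
Lemma ltr_rc s t : (rc s < rc t) = (s < t).
Proof. by rewrite cplx_lt !cE eqxx. Qed.
Lemma conj_rc t : (rc t)^* = rc t.
Proof. by apply: cplx_eq; rewrite !cE ?oppr0. Qed.

Lemma ge0_rc z : 0 <= z -> z = rc (re z).
Proof. by rewrite cplx_le => /andP[/eqP h _]; apply: cplx_eq; rewrite !cE. Qed.
Lemma gt0_rc z : 0 < z -> z = rc (re z) /\ 0 < re z.
Proof.
rewrite cplx_lt !cE => /andP[/eqP h ?]; split=> //.
by apply: cplx_eq; rewrite !cE.
Qed.

Lemma normE z : `|z| = rc (Num.sqrt (re z ^+ 2 + im z ^+ 2)).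
Proof. exact: normc_def. Qed.

Lemma norm_rc t : `|rc t| = rc `|t|.
Proof. by rewrite normE !cE expr0n addr0 sqrtr_sqr. Qed.

Lemma norm_le z t : `|re z| + `|im z| <= t -> `|z| <= rc t.
Proof.
move=> h; rewrite normE ler_rc; apply: le_trans h.
rewrite -[X in _ <= X]ger0_norm ?addr_ge0 // -sqrtr_sqr ler_sqrt ?sqr_ge0 //.
rewrite sqrrD !real_normK ?num_real // lerD2r lerDl.
by rewrite mulrn_wge0 // mulr_ge0.
Qed.

Lemma norm_re z t : `|z| <= rc t -> `|re z| <= t.
Proof.
rewrite normE ler_rc; apply: le_trans.
by rewrite -sqrtr_sqr ler_wsqrtr // lerDl sqr_ge0.
Qed.

Lemma norm_im z t : `|z| <= rc t -> `|im z| <= t.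
Proof.
rewrite normE ler_rc; apply: le_trans.
by rewrite -sqrtr_sqr ler_wsqrtr // lerDr sqr_ge0.
Qed.

End ComplexScalars.

(** * Inner products *)

Section Hilbert.
Variables (R : realType) (H : completeNormedModType (cplx R)).
Local Notation C := (cplx R).
Variable dot : {dot H for Num.conj}.
Hypothesis dot_norm : forall x : H, dot x x = `|x| ^+ 2.
Implicit Types (x y z v : H) (a : C) (s t e : R).

Definition rscale t x : H := rc t *: x.
Definition nrm x : R := re `|x|.
Definition ip x y : R := re (dot x y).

Lemma dotC x y : dot y x = (dot x y)^*.
Proof. by rewrite hermC /= expr0 mul1r. Qed.
Lemma dotDl x y z : dot (x + y) z = dot x z + dot y z.
Proof. exact: linearDl. Qed.
Lemma dotDr x y z : dot z (x + y) = dot z x + dot z y.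
Proof. exact: linearDr. Qed.
Lemma dotNl x z : dot (- x) z = - dot x z.
Proof. exact: linearNl. Qed.
Lemma dotNr x z : dot z (- x) = - dot z x.
Proof. exact: linearNr. Qed.
Lemma dotZl a x z : dot (a *: x) z = a * dot x z.
Proof. exact: linearZl_LR. Qed.
Lemma dotZr a x z : dot z (a *: x) = a^* * dot z x.
Proof. exact: linearZr_LR. Qed.
Lemma dot0l z : dot 0 z = 0. Proof. exact: linear0l. Qed.
Lemma dot0r z : dot z 0 = 0. Proof. exact: linear0r. Qed.

Definition dotE := (dotDl, dotDr, dotNl, dotNr, dotZl, dotZr, dot0l, dot0r).

Lemma ipC x y : ip x y = ip y x. Proof. by rewrite /ip dotC re_conj. Qed.
Lemma ipDl x y z : ip (x + y) z = ip x z + ip y z.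
Proof. by rewrite /ip dotE reD. Qed.
Lemma ipDr x y z : ip z (x + y) = ip z x + ip z y.
Proof. by rewrite /ip dotE reD. Qed.
Lemma ipNl x z : ip (- x) z = - ip x z. Proof. by rewrite /ip dotE reN. Qed.
Lemma ipNr x z : ip z (- x) = - ip z x. Proof. by rewrite /ip dotE reN. Qed.
Lemma ipZl t x z : ip (rscale t x) z = t * ip x z.
Proof. by rewrite /ip dotE !cE mul0r subr0. Qed.
Lemma ipZr t x z : ip z (rscale t x) = t * ip z x.
Proof. by rewrite ipC ipZl ipC. Qed.
Lemma ip0l z : ip 0 z = 0. Proof. by rewrite /ip dotE. Qed.
Lemma ip0r z : ip z 0 = 0. Proof. by rewrite /ip dotE. Qed.

Definition ipE := (ipDl, ipDr, ipNl, ipNr, ipZl, ipZr, ip0l, ip0r).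

Lemma normHE x : `|x| = rc (nrm x).
Proof. exact: ge0_rc. Qed.
Lemma nrm_ge0 x : 0 <= nrm x.
Proof. by rewrite -ler_rc -normHE; exact: normr_ge0. Qed.
Lemma dotxx x : dot x x = rc (nrm x ^+ 2).
Proof. by rewrite dot_norm normHE !expr2 rcM. Qed.
Lemma nrm_sqr x : nrm x ^+ 2 = ip x x.
Proof. by rewrite /ip dotxx. Qed.
Lemma ip_ge0 x : 0 <= ip x x. Proof. by rewrite -nrm_sqr sqr_ge0. Qed.
Lemma nrm0P x : nrm x = 0 -> x = 0.
Proof. by move=> h; apply/normr0_eq0; rewrite normHE h. Qed.
Lemma nrm0 : nrm 0 = 0. Proof. by rewrite /nrm normr0. Qed.
Lemma nrmN x : nrm (- x) = nrm x. Proof. by rewrite /nrm normrN. Qed.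
Lemma nrmD x y : nrm (x + y) <= nrm x + nrm y.
Proof. by rewrite -ler_rc rcD -!normHE ler_normD. Qed.
Lemma nrmZ a x : nrm (a *: x) = re `|a| * nrm x.
Proof. by rewrite /nrm normrZ normHE reM !cE mulr0 subr0. Qed.
Lemma nrmZr t x : nrm (rscale t x) = `|t| * nrm x.
Proof. by rewrite nrmZ norm_rc. Qed.

(** The discriminant of the nonnegative quadratic polynomial
    t |-> f (x + t y) (x + t y). *)
Lemma form_cauchy_schwarz (f : H -> H -> R) :
  (forall x y z, f (x + y) z = f x z + f y z) ->
  (forall t x y, f (rscale t x) y = t * f x y) ->
  (forall x y, f x y = f y x) -> (forall x, 0 <= f x x) ->
  forall x y, f x y ^+ 2 <= f x x * f y y.
Proof.
move=> fD fZ fC f0 x y.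
have key t : 0 <= f x x + 2 * t * f x y + t ^+ 2 * f y y.
  have := f0 (x + rscale t y).
  rewrite fD fZ ![f _ (x + _)]fC !fD !fZ [f y x]fC => h.
  by apply: le_trans h _; rewrite le_eqVlt; apply/orP; left; apply/eqP; ring.
have := f0 y; rewrite le_eqVlt => /orP[/eqP b0|b0].
  rewrite -b0 mulr0; have [->|c0] := eqVneq (f x y) 0; first by rewrite expr0n.
  have := key (- (f x x + 1) / (2 * f x y)).
  have -> : 2 * (- (f x x + 1) / (2 * f x y)) * f x y = - (f x x + 1).
    by field.
  by rewrite -b0 mulr0; lra.
have := key (- f x y / f y y).
have -> : f x x + 2 * (- f x y / f y y) * f x y + (- f x y / f y y) ^+ 2 * f y y
  = (f x x * f y y - f x y ^+ 2) / f y y by field; rewrite gt_eqF.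
by rewrite pmulr_lge0 ?invr_gt0 // subr_ge0.
Qed.

Lemma ip_le x y : `|ip x y| <= nrm x * nrm y.
Proof.
have h : ip x y ^+ 2 <= ip x x * ip y y.
  by apply: form_cauchy_schwarz; [exact: ipDl|exact: ipZl|exact: ipC|exact: ip_ge0].
rewrite -sqrtr_sqr -(@ger0_norm _ (nrm x * nrm y)) ?mulr_ge0 ?nrm_ge0 //.
by rewrite -[X in _ <= X]sqrtr_sqr ler_wsqrtr // exprMn !nrm_sqr.
Qed.

(** Real inner products determine complex ones, so estimates and stationarity
    need only be established for the real form [ip]. *)
Lemma im_dot x y : im (dot x y) = ip x (ci R *: y).
Proof. by rewrite /ip dotE !cE; ring. Qed.

Lemma nrm_ci x : nrm (ci R *: x) = nrm x.
Proof. by rewrite nrmZ normE !cE expr0n add0r expr1n sqrtr1 mul1r. Qed.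

Lemma dot_le x y : `|dot x y| <= rc (2 * (nrm x * nrm y)).
Proof.
apply: norm_le; have h1 := ip_le x y; have := ip_le x (ci R *: y).
by rewrite nrm_ci -im_dot; rewrite /ip in h1; lra.
Qed.

Lemma cvg0P (u : nat -> C) : (u n @[n --> \oo] --> (0 : C)) <->
  (forall e, 0 < e -> exists N, forall n, (N <= n)%N -> `|u n| <= rc e).
Proof.
split=> [/cvgr0Pnorm_le h e e0|h].
  have [|N _ hN] := h (rc e); first by rewrite -[0]rc0 ltr_rc.
  by exists N => n Nn; exact: hN.
apply/cvgr0Pnorm_le => e /gt0_rc[-> e0].
by have [N hN] := h _ e0; exists N.
Qed.

Lemma hilbert_complete (v : nat -> H) :
  (forall e, 0 < e -> exists N, forall m n, (N <= m)%N -> (N <= n)%N ->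
     nrm (v m - v n) <= e) ->
  exists p, forall e, 0 < e -> exists N, forall n, (N <= n)%N -> nrm (p - v n) <= e.
Proof.
move=> cau.
have : cvg (v n @[n --> \oo]).
  apply/cauchy_cvgP/cauchyP => e /gt0_rc[-> e0].
  have [|N hN] := cau (re e / 2); first by rewrite divr_gt0.
  exists (v N); exists N => // n /= Nn.
  rewrite -ball_normE /= normHE ltr_rc.
  apply: le_lt_trans (hN _ _ (leqnn N) Nn) _; lra.
move=> /cvgrPdist_le h; exists (lim (v n @[n --> \oo])) => e e0.
have [|N _ hN] := h (rc e); first by rewrite -[0]rc0 ltr_rc.
exists N => n Nn; rewrite -ler_rc -normHE; exact: hN.
Qed.

Lemma parallelogram x y : ip (x + y) (x + y) + ip (x - y) (x - y) =
  2 * ip x x + 2 * ip y y.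
Proof. by rewrite !ipE (ipC y x); ring. Qed.

End Hilbert.

(** * Orthogonal projections and adjoints *)

Section Adjoints.
Variables (R : realType) (H : completeNormedModType (cplx R)).
Local Notation C := (cplx R).
Variable dot : {dot H for Num.conj}.
Hypothesis dot_norm : forall x : H, dot x x = `|x| ^+ 2.
Implicit Types (x y z v : H) (a : C) (s t e : R) (f g T : H -> H).
Local Notation ip := (ip dot).

Lemma dot_eq0 x : (forall y, dot y x = 0) -> x = 0.
Proof.
by move=> /(_ x); rewrite dot_norm => /eqP; rewrite expf_eq0 normr_eq0 => /eqP.
Qed.

Lemma dot_inj x y : (forall z, dot z x = dot z y) -> x = y.
Proof.
move=> h; apply/eqP; rewrite -subr_eq0; apply/eqP/dot_eq0 => z.
by rewrite !dotE h subrr.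
Qed.

(** Minimising sequences for the distance from x to V are Cauchy by the
    parallelogram law, and at the limit the distance is stationary along V.
    As V need not be closed, p is described by approximation from V. *)
Lemma projection (V : set H) : V 0 ->
  (forall x y, V x -> V y -> V (x + y)) -> (forall a x, V x -> V (a *: x)) ->
  forall x, exists p, (forall e, 0 < e -> exists2 v, V v & nrm (p - v) <= e) /\
    (forall v, V v -> dot (x - p) v = 0).
Proof.
move=> V0 VD VZ x.
pose D := [set ip (x - v) (x - v) | v in V].
have Dinf : has_inf D.
  split; first by exists (ip (x - 0) (x - 0)); exists 0.
  by exists 0 => _ [v _ <-]; exact: ip_ge0.
pose d := inf D.
have dlb v : V v -> d <= ip (x - v) (x - v).
  by move=> Vv; apply: ge_inf; [case: Dinf|exists v].
have dn n : exists v, V v /\ ip (x - v) (x - v) < d + n.+1%:R^-1.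
  have [|_ [v Vv <-] hv] := @inf_adherent _ D n.+1%:R^-1 _ Dinf.
    by rewrite invr_gt0.
  by exists v.
have [v hv] := choice dn.
have vcau m n : nrm (v m - v n) ^+ 2 <= 2 * m.+1%:R^-1 + 2 * n.+1%:R^-1.
  have [Vm hm] := hv m; have [Vn hn] := hv n.
  have := dlb (rscale 2^-1 (v m + v n)) (VZ _ _ (VD _ _ Vm Vn)).
  have := parallelogram dot (x - v m) (x - v n).
  rewrite (nrm_sqr dot_norm).
  have -> : x - v m - (x - v n) = - (v m - v n) by rewrite !opprB addrC addrA subrK.
  rewrite -[X in ip X X + _](_ : rscale 2 (x - rscale 2^-1 (v m + v n)) = _); last first.
    rewrite /rscale scalerBr scalerA -rcM mulfV ?pnatr_eq0 // rc1 scale1r.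
    by rewrite rcD rc1 scalerDl scale1r opprD addrACA.
  rewrite !ipZl !ipZr ipNl ipNr opprK.
  by move: hm hn; move: (m.+1%:R^-1) (n.+1%:R^-1) => em en; lra.
have [p hp] : exists p, forall e, 0 < e ->
    exists N, forall n, (N <= n)%N -> nrm (p - v n) <= e.
  apply: hilbert_complete => e e0.
  have e20 : 0 < e ^+ 2 / 4 by rewrite divr_gt0 ?exprn_gt0.
  have [N hN] := inv_small e20.
  exists N => m n Nm Nn.
  rewrite -(@ler_pXn2r _ 2) // ?nnegrE ?nrm_ge0 ?(ltW e0) //.
  apply: le_trans (vcau m n) _; move: (hN _ Nm) (hN _ Nn).
  by move: (m.+1%:R^-1) (n.+1%:R^-1) => em en; lra.
exists p; split.
  move=> e /hp[N hN]; exists (v N); [by case: (hv N)|exact: hN].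
suff key u : V u -> ip (x - p) u = 0.
  move=> u Vu; apply: cplx_eq; first exact: key.
  by rewrite im_dot // key //; exact: VZ.
move=> Vu.
(* d <= |x - v n + t u|^2 for every n; the limit in n. *)
have quad t : 0 <= 2 * t * ip (x - p) u + t ^+ 2 * ip u u.
  rewrite -oppr_le0; apply: (@limit_le0 _ _ (1 + 2 * `|t| * nrm u)) => e e0.
  have [N1 hN1] := hp _ e0; have [N2 hN2] := inv_small e0.
  pose n := maxn N1 N2; have ne := hN2 n (leq_maxr _ _).
  have [Vn hn] := hv n.
  have := dlb _ (VD _ _ Vn (VZ (rc (- t)) _ Vu)).
  rewrite -/(rscale (- t) u).
  have -> : ip (x - (v n + rscale (- t) u)) (x - (v n + rscale (- t) u)) =
     ip (x - v n) (x - v n) + 2 * t * (ip (p - v n) u + ip (x - p) u) + t ^+ 2 * ip u u.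
    rewrite !ipE !(ipC dot _ u) !(ipC dot _ (v n)) !(ipC dot _ p); ring.
  have : 2 * t * ip (p - v n) u <= 2 * `|t| * nrm u * e.
    apply: le_trans (ler_norm _) _.
    rewrite !normrM (ger0_norm (ler0n _ 2)) -!mulrA !ler_wpM2l //.
    apply: le_trans (ip_le dot_norm _ _) _.
    by rewrite mulrC ler_wpM2l ?nrm_ge0 // hN1 // leq_maxl.
  by move: hn ne; move: (n.+1%:R^-1) => en; lra.
(* The quadratic is negative at the t chosen here unless ip (x - p) u = 0; the
   added 1 keeps the denominator nonzero when u = 0. *)
have u0 := ip_ge0 dot_norm u.
have u1 : ip u u + 1 != 0 by rewrite gt_eqF //; lra.
have := quad (- ip (x - p) u / (ip u u + 1)).
have -> : 2 * (- ip (x - p) u / (ip u u + 1)) * ip (x - p) u +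
  (- ip (x - p) u / (ip u u + 1)) ^+ 2 * ip u u =
  - (ip (x - p) u / (ip u u + 1)) ^+ 2 * (ip u u + 2) by field.
rewrite mulNr oppr_ge0 pmulr_lle0; last lra.
move=> h; have : (ip (x - p) u / (ip u u + 1)) ^+ 2 == 0.
  by rewrite eq_le h sqr_ge0.
by rewrite expf_eq0 /= mulf_eq0 invr_eq0 (negPf u1) orbF => /eqP.
Qed.

(** The functional is a multiple of the inner product with w, the part of a
    vector x0 outside the kernel that is orthogonal to the kernel: x minus a
    suitable multiple of w lies in the kernel. *)
Lemma riesz (phi : H -> C) (M : R) :
  (forall a x y, phi (a *: x + y) = a * phi x + phi y) ->
  (forall x, `|phi x| <= rc (M * nrm x)) -> exists z, forall x, phi x = dot x z.
Proof.
move=> phiL phiM.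
have phi0 : phi 0 = 0.
  have := phiL 1 0 0; rewrite scale1r mul1r addr0 => /eqP.
  by rewrite -subr_eq0 opprD addrA subrr add0r oppr_eq0 => /eqP.
have phiD x y : phi (x + y) = phi x + phi y.
  by have := phiL 1 x y; rewrite scale1r mul1r.
have phiZ a x : phi (a *: x) = a * phi x.
  by have := phiL a x 0; rewrite addr0 phi0 addr0.
have phiN x : phi (- x) = - phi x by rewrite -scaleN1r phiZ mulN1r.
have [h|] := pselect (forall x, phi x = 0).
  by exists 0 => x; rewrite h dot0r.
move=> /existsNP[x0 nz].
have [||x y|p [cl orth]] := projection (V := [set x | phi x = 0]) _ _ _ x0.
- exact: phi0.
- by move=> x y /= hx hy; rewrite phiD hx hy addr0.
- by move=> /= hx; rewrite phiZ hx mulr0.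
have pp : phi p = 0.
  apply/eqP; rewrite -normr_eq0 eq_le normr_ge0 andbT normE -[0]rc0 ler_rc.
  apply: (@limit_le0 _ _ `|M|) => e e0; have [v /= hv hpv] := cl _ e0.
  rewrite -ler_rc -normE; have -> : phi p = phi (p - v) by rewrite phiD phiN hv subr0.
  apply: le_trans (phiM _) _; rewrite ler_rc.
  apply: (@le_trans _ _ (`|M| * nrm (p - v))); last by rewrite ler_wpM2l.
  by rewrite ler_wpM2r ?nrm_ge0 // ler_norm.
pose w := x0 - p.
have pw : phi w = phi x0 by rewrite phiD phiN pp subr0.
have w0 : dot w w != 0.
  rewrite dot_norm expf_eq0 normr_eq0 /=; apply/eqP => w0.
  by apply: nz; rewrite -pw w0 phi0.
have worth v : phi v = 0 -> dot w v = 0 by exact: orth.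
clearbody w; exists ((phi w / dot w w)^* *: w) => x.
have pw0 : phi w != 0 by rewrite pw; apply/eqP.
have : dot w (x - (phi x / phi w) *: w) = 0.
  by apply: worth; rewrite phiD phiN phiZ divfK ?subrr.
rewrite dotC => /eqP; rewrite conjC_eq0 !dotE conjCK subr_eq0 => /eqP ->.
by move: (phi x) (phi w) (dot w w) pw0 w0 => a b c b0 c0; field; rewrite b0 c0.
Qed.

Lemma boundedP T : bounded_operator T <->
  (forall a x y, T (a *: x + y) = a *: T x + T y) /\
  exists2 M : R, 0 <= M & forall x, nrm (T x) <= M * nrm x.
Proof.
split=> [[TL [M hM]]|[TL [M M0 hM]]]; split=> //.
  exists `|re M| => // x; have := hM x; rewrite !normHE cplx_le reM !cE !mulr0 subr0.
  move=> /andP[_ h]; apply: le_trans h _; by rewrite ler_wpM2r ?nrm_ge0 // ler_norm.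
by exists (rc M) => x; rewrite !normHE -rcM ler_rc.
Qed.

Section AdjointTheory.
Variable T : H -> H.
Hypothesis T_bounded : bounded_operator T.

Lemma adjointP x y : dot (T x) y = dot x (adjoint dot T y).
Proof.
have /boundedP[TL [M M0 hM]] := T_bounded.
have [z hz] : exists z, forall x, dot (T x) y = dot x z.
  apply: (@riesz _ (2 * M * nrm y)) => [a u v|u]; first by rewrite TL !dotE.
  apply: le_trans (dot_le dot_norm _ _) _; rewrite ler_rc.
  rewrite -!mulrA ler_wpM2l // [nrm y * _]mulrC mulrA.
  by rewrite ler_wpM2r ?nrm_ge0.
rewrite /adjoint; case: xgetP => [w _ ->//|/(_ z)]; by case.
Qed.

Lemma adjointPr x y : dot x (T y) = dot (adjoint dot T x) y.
Proof. by rewrite dotC adjointP -dotC. Qed.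

Lemma adjoint_unique S : (forall x y, dot (T x) y = dot x (S y)) -> adjoint dot T = S.
Proof.
by move=> h; apply/funext => y; apply: dot_inj => x; rewrite -adjointP h.
Qed.

End AdjointTheory.

Lemma ip_op_le f (M : R) x : nrm (f x) <= M * nrm x -> ip (f x) x <= M * ip x x.
Proof.
move=> h; apply: le_trans (ler_norm _) _; apply: le_trans (ip_le dot_norm _ _) _.
by rewrite -(nrm_sqr dot_norm) expr2 mulrA ler_wpM2r ?nrm_ge0.
Qed.

(** |T^* x|^2 = (T T^* x, x) <= M |T^* x| |x|. *)
Lemma adjoint_bound T (M : R) : bounded_operator T -> 0 <= M ->
  (forall x, nrm (T x) <= M * nrm x) ->
  forall x, nrm (adjoint dot T x) <= M * nrm x.
Proof.
move=> Tb M0 hM x; set y := adjoint dot T x.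
have [->|y0] := eqVneq (nrm y) 0; first by rewrite mulr_ge0 ?nrm_ge0.
have yp : 0 < nrm y by rewrite lt_neqAle eq_sym y0 nrm_ge0.
rewrite -(ler_pM2r yp) -expr2 (nrm_sqr dot_norm) /ip -adjointP // -/(ip _ _).
apply: le_trans (ler_norm _) _; apply: le_trans (ip_le dot_norm _ _) _.
apply: le_trans (ler_wpM2r (nrm_ge0 _) (hM y)) _.
by rewrite mulrAC.
Qed.

Lemma adjoint_bounded T : bounded_operator T -> bounded_operator (adjoint dot T).
Proof.
move=> Tb; have /boundedP[TL [M M0 hM]] := Tb; apply/boundedP; split.
  by move=> a x y; apply: dot_inj => z; rewrite -adjointP // !dotE -!adjointP.
by exists M => //; exact: adjoint_bound.
Qed.

Lemma boundedD f g : bounded_operator f -> bounded_operator g -> bounded_operator (f + g).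
Proof.
move=> /boundedP[fL [M M0 hM]] /boundedP[gL [N N0 hN]]; apply/boundedP; split.
  by move=> a x y; rewrite !fctE fL gL scalerDr addrACA.
exists (M + N); rewrite ?addr_ge0 // => x; rewrite fctE mulrDl.
by apply: le_trans (nrmD _ _) _; rewrite lerD.
Qed.

Lemma boundedZ a f : bounded_operator f -> bounded_operator (a *: f).
Proof.
move=> /boundedP[fL [M M0 hM]]; apply/boundedP; split.
  by move=> b x y; rewrite !fctE fL scalerDr !scalerA mulrC.
have a0 : 0 <= re `|a| by have := normr_ge0 a; rewrite cplx_le => /andP[].
exists (re `|a| * M) => [|x]; first by rewrite mulr_ge0.
by rewrite fctE nrmZ -mulrA ler_wpM2l.
Qed.

Lemma bounded_comp f g : bounded_operator f -> bounded_operator g ->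
  bounded_operator (f \o g).
Proof.
move=> /boundedP[fL [M M0 hM]] /boundedP[gL [N N0 hN]]; apply/boundedP; split.
  by move=> a x y /=; rewrite gL fL.
exists (M * N); rewrite ?mulr_ge0 // => x /=; apply: le_trans (hM _) _.
by rewrite -mulrA ler_wpM2l.
Qed.

Lemma bounded_id : bounded_operator (@idfun H).
Proof. by apply/boundedP; split=> //; exists 1 => // x; rewrite mul1r. Qed.

(** Makes the family of C*-algebras defining [cstar_generated] nonempty, whence
    the elements of the intersection are bounded. *)
Lemma bounded_cstar : cstar_subalgebra dot (@bounded_operator R H).
Proof.
split.
- by [].
- exact: bounded_id.
- exact: boundedD.
- exact: boundedZ.
- exact: bounded_comp.
- exact: adjoint_bounded.
- by move=> f fb _.
Qed.

Lemma cstar_generated_sub T : cstar_generated dot T T.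
Proof. by move=> A. Qed.

Lemma cstar_generated_cstar T : bounded_operator T ->
  cstar_subalgebra dot (cstar_generated dot T).
Proof.
move=> Tb; split=> [f hf||f g hf hg|a f hf|f g hf hg|f hf|f fb hf].
- exact: (hf _ bounded_cstar).
- by move=> A cA _; exact: csa_id cA.
- by move=> A cA AT; apply: (csa_add cA); [exact: hf|exact: hg].
- by move=> A cA AT; apply: (csa_scale cA); exact: hf.
- by move=> A cA AT; apply: (csa_comp cA); [exact: hf|exact: hg].
- by move=> A cA AT; apply: (csa_adjoint cA); exact: hf.
- move=> A cA AT; apply: (csa_closed cA) => // e /hf[g hg he].
  by exists g => //; exact: hg.
Qed.
End Adjoints.

(** * Square roots of positive operators *)

Section SquareRoot.
Variables (R : realType) (H : completeNormedModType (cplx R)).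
Local Notation C := (cplx R).
Variable dot : {dot H for Num.conj}.
Hypothesis dot_norm : forall x : H, dot x x = `|x| ^+ 2.
Implicit Types (x y z v : H) (a : C) (s t e : R) (f g T : H -> H).
Local Notation ip := (ip dot).

Definition symmetric_op f := forall x y, dot (f x) y = dot x (f y).

Lemma symmetric_adjoint f : bounded_operator f -> symmetric_op f -> adjoint dot f = f.
Proof. by move=> fb fs; apply: adjoint_unique. Qed.

Lemma linear_opD f : bounded_operator f -> forall x y, f (x + y) = f x + f y.
Proof. by case=> fL _ x y; have := fL 1 x y; rewrite !scale1r. Qed.

Lemma linear_op0 f : bounded_operator f -> f 0 = 0.
Proof.
move=> /linear_opD/(_ 0 0)/eqP; rewrite addr0 -subr_eq0 opprD addrA subrr add0r.
by rewrite oppr_eq0 => /eqP.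
Qed.

Lemma linear_opZ f : bounded_operator f -> forall a x, f (a *: x) = a *: f x.
Proof.
by move=> fb a x; have [/(_ a x 0) + _] := fb; rewrite !addr0 linear_op0 // addr0.
Qed.

Lemma linear_opN f : bounded_operator f -> forall x, f (- x) = - f x.
Proof. by move=> fb x; rewrite -scaleN1r linear_opZ // scaleN1r. Qed.

Lemma symmetric_ip f x y : symmetric_op f -> ip (f x) y = ip x (f y).
Proof. by move=> fs; congr (re _). Qed.

(** Cauchy--Schwarz for the form (f x, y), at y = f x. *)
Lemma positive_op_norm f (M : R) : bounded_operator f -> symmetric_op f ->
  (forall x, 0 <= ip (f x) x <= M * ip x x) ->
  forall x, nrm (f x) ^+ 2 <= M * ip (f x) x.
Proof.
move=> fb fs f0 x; rewrite (nrm_sqr dot_norm); set G := ip (f x) (f x).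
have G0 : 0 <= G by exact: ip_ge0.
have /andP[q0 q1] := f0 x; have /andP[_ q2] := f0 (f x).
have : G ^+ 2 <= ip (f x) x * ip (f (f x)) (f x).
  apply: (@form_cauchy_schwarz _ _ (fun x y => ip (f x) y)).
  - by move=> u v w; rewrite linear_opD // ipDl.
  - by move=> t u v; rewrite linear_opZ // ipZl.
  - by move=> u v; rewrite symmetric_ip // ipC.
  - by move=> u; have /andP[] := f0 u.
rewrite -/G in q2 *.
move=> h; have {}h : G * G <= (M * ip (f x) x) * G.
  rewrite -expr2; apply: le_trans h _; rewrite [M * _]mulrC -mulrA.
  by rewrite ler_wpM2l.
have [G0'|] := eqVneq G 0; last first.
  by move=> Gn; rewrite -(@ler_pM2r _ G) // lt_neqAle eq_sym Gn.
rewrite G0'; have [->|n0] := eqVneq (ip (f x) x) 0; first by rewrite mulr0.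
have x0 : 0 < ip x x.
  rewrite lt_neqAle ip_ge0 // andbT eq_sym; apply: contra n0.
  by rewrite -(nrm_sqr dot_norm) expf_eq0 /= => /eqP/nrm0P ->; rewrite ip0r.
have M0 : 0 <= M by rewrite -(pmulr_lge0 _ x0); apply: le_trans q0 q1.
exact: mulr_ge0.
Qed.

Lemma vec_eq x y (K : R) : (forall e, 0 < e -> nrm (x - y) <= K * e) -> x = y.
Proof.
move=> h; apply/eqP; rewrite -subr_eq0; apply/eqP/nrm0P/eqP.
by rewrite eq_le nrm_ge0 andbT (limit_le0 h).
Qed.

Section Iteration.
Variables (A : set (H -> H)) (S : H -> H) (r : R).
Hypotheses (A_cstar : cstar_subalgebra dot A) (A_S : A S).
Hypothesis S_sym : symmetric_op S.
Hypotheses (r01 : 0 <= r < 1) (S_le : forall x, nrm (S x) <= r * nrm x).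

(** If Y = (S + Y^2) / 2 then (1 - Y)^2 = 1 - S; the map Y |-> (S + Y^2) / 2
    contracts the ball of radius r < 1 by the factor r. *)
Fixpoint sqrt_iter n : H -> H :=
  if n is m.+1 then rc 2^-1 *: (S + (sqrt_iter m \o sqrt_iter m)) else 0 *: idfun.
Local Notation Y_ := sqrt_iter.

Lemma sqrt_iterS n x : Y_ n.+1 x = rc 2^-1 *: (S x + Y_ n (Y_ n x)).
Proof. by []. Qed.

Lemma sqrt_iter_mem n : A (Y_ n).
Proof.
elim: n => [|n IH] /=; first by apply: csa_scale A_cstar _ _ (csa_id A_cstar).
by apply: (csa_scale A_cstar); apply: (csa_add A_cstar) => //; exact: (csa_comp A_cstar).
Qed.

Lemma sqrt_iter_bounded n : bounded_operator (Y_ n).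
Proof. exact: csa_bounded A_cstar _ (sqrt_iter_mem n). Qed.

Lemma sqrt_iter_sym n : symmetric_op (Y_ n).
Proof.
elim: n => [|n IH] x y; first by rewrite /= !fctE !scale0r dot0l dot0r.
by rewrite !sqrt_iterS !dotE conj_rc S_sym !IH.
Qed.

Lemma nrm_half x : nrm (rc 2^-1 *: x) = 2^-1 * nrm x.
Proof. by rewrite -/(rscale _ _) nrmZr ger0_norm // invr_ge0. Qed.

Lemma sqrt_iter_le n x : nrm (Y_ n x) <= r * nrm x.
Proof.
have /andP[r0 r1] := r01.
elim: n x => [|n IH] x; first by rewrite /= fctE scale0r nrm0 mulr_ge0 ?nrm_ge0.
rewrite sqrt_iterS nrm_half; have := nrmD (S x) (Y_ n (Y_ n x)).
have := S_le x; have := IH (Y_ n x).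
have : r * nrm (Y_ n x) <= 1 * nrm (Y_ n x) by rewrite ler_wpM2r ?nrm_ge0 // ltW.
have := IH x; lra.
Qed.

(** Y'^2 - Y^2 = Y' (Y' - Y) + (Y' - Y) Y, whether or not Y and Y' commute. *)
Lemma sqrt_iter_step n x : nrm (Y_ n.+1 x - Y_ n x) <= r ^+ n * nrm x.
Proof.
have /andP[r0 r1] := r01.
elim: n x => [|n IH] x.
  have -> : Y_ 0 x = 0 by rewrite /= fctE scale0r.
  rewrite subr0 expr0 mul1r; apply: le_trans (sqrt_iter_le _ _) _.
  by rewrite ler_piMl ?nrm_ge0 // ltW.
rewrite [Y_ n.+2 x]sqrt_iterS [X in _ - X]sqrt_iterS -scalerBr nrm_half.
set y := Y_ n.+1 x; set z := Y_ n x.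
have -> : S x + Y_ n.+1 y - (S x + Y_ n z) =
   Y_ n.+1 (y - z) + (Y_ n.+1 z - Y_ n z).
  rewrite (linear_opD (sqrt_iter_bounded n.+1)) (linear_opN (sqrt_iter_bounded n.+1)).
  by apply: (dot_inj dot_norm) => u; rewrite !dotE; ring.
have := nrmD (Y_ n.+1 (y - z)) (Y_ n.+1 z - Y_ n z).
have := sqrt_iter_le n.+1 (y - z).
have : r * nrm (y - z) <= r * (r ^+ n * nrm x).
  by rewrite ler_wpM2l // IH.
have := IH z.
have : r ^+ n * nrm z <= r ^+ n * (r * nrm x).
  by rewrite ler_wpM2l ?exprn_ge0 // sqrt_iter_le.
by rewrite exprS; lra.
Qed.

(** The geometric sum of the steps, kept in closed form for the induction. *)
Lemma sqrt_iter_diff n k x :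
  nrm (Y_ (n + k) x - Y_ n x) <= (r ^+ n - r ^+ (n + k)) / (1 - r) * nrm x.
Proof.
have /andP[r0 r1] := r01; have r1' : 1 - r != 0 by rewrite subr_eq0 eq_sym lt_eqF.
elim: k => [|k IH]; first by rewrite addn0 !subrr mul0r mul0r nrm0.
rewrite addnS -(subrK (Y_ (n + k) x) (Y_ _.+1 x)) -addrA.
apply: le_trans (nrmD _ _) _; apply: le_trans (lerD (sqrt_iter_step _ _) IH) _.
rewrite -mulrDl ler_wpM2r ?nrm_ge0 // le_eqVlt; apply/orP; left; apply/eqP.
by rewrite exprS; field.
Qed.

(** The limit of the iteration, so that 1 - Y is a square root of 1 - S. The
    convergence is uniform on bounded sets, which puts Y in the algebra. *)
Lemma square_root : exists Y : H -> H, [/\ A Y, bounded_operator Y, symmetric_op Y &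
  forall x, Y (Y x) = Y x + Y x - S x].
Proof.
have /andP[r0 r1] := r01; have r1' : 0 < 1 - r by rewrite subr_gt0.
have tail n k x : nrm (Y_ (n + k) x - Y_ n x) <= r ^+ n / (1 - r) * nrm x.
  apply: le_trans (sqrt_iter_diff n k x) _.
  rewrite ler_wpM2r ?nrm_ge0 // ler_wpM2r ?invr_ge0 ?(ltW r1') //.
  by rewrite gerBl exprn_ge0.
have ex x : exists p, forall e, 0 < e ->
    exists N, forall n, (N <= n)%N -> nrm (p - Y_ n x) <= e.
  apply: hilbert_complete => e e0.
  have d0 : 0 < e * (1 - r) / (2 * (nrm x + 1)).
    by rewrite divr_gt0 ?mulr_gt0 // ltr_wpDl // nrm_ge0.
  have [N hN] := geometric_small r01 d0.
  have small m : (N <= m)%N -> nrm (Y_ m x - Y_ N x) <= e / 2.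
    move=> Nm; rewrite -(subnKC Nm); apply: le_trans (tail _ _ _) _.
    have x1 : 0 < nrm x + 1 by rewrite ltr_wpDl // nrm_ge0.
    apply: (@le_trans _ _ (e * (1 - r) / (2 * (nrm x + 1)) / (1 - r) * (nrm x + 1))).
      apply: ler_pM; rewrite ?nrm_ge0 ?mulr_ge0 ?exprn_ge0 ?invr_ge0 ?(ltW r1') //.
        by rewrite ler_wpM2r ?invr_ge0 ?(ltW r1') // hN.
      by rewrite lerDl.
    rewrite le_eqVlt; apply/orP; left; apply/eqP; field.
    by rewrite !gt_eqF.
  exists N => m n /small hm /small hn.
  rewrite -(subrK (Y_ N x) (Y_ m x)) -addrA; apply: le_trans (nrmD _ _) _.
  by rewrite -(opprB (Y_ n x)) nrmN; lra.
have [Y hY] := choice ex.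
have uni e : 0 < e -> exists N, forall n x, (N <= n)%N -> nrm (Y x - Y_ n x) <= e * nrm x.
  move=> e0; have d0 : 0 < e * (1 - r) by rewrite mulr_gt0.
  have [N hN] := geometric_small r01 d0.
  exists N => n x Nn; rewrite -subr_le0.
  apply: (@limit_le0 _ _ 1) => d /(hY x)[M hM]; rewrite mul1r lerBlDr.
  have := hM _ (leq_addl n M); have := tail n M x.
  have : r ^+ n / (1 - r) * nrm x <= e * nrm x.
    by rewrite ler_wpM2r ?nrm_ge0 // ler_pdivrMr // hN.
  have := nrmD (Y x - Y_ (n + M) x) (Y_ (n + M) x - Y_ n x).
  by rewrite addrA subrK; lra.
have uni1 e : 0 < e -> exists n, forall x, nrm (Y x - Y_ n x) <= e * nrm x.
  by move=> /uni[N hN]; exists N => x; exact: hN.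
have Yle x : nrm (Y x) <= r * nrm x.
  rewrite -subr_le0; apply: (@limit_le0 _ _ (nrm x)) => e /uni1[n hn].
  have := hn x; have := sqrt_iter_le n x; have := nrmD (Y x - Y_ n x) (Y_ n x).
  by rewrite subrK; lra.
have Yb : bounded_operator Y.
  apply/boundedP; split; last by exists r.
  move=> a x y.
  apply: (@vec_eq _ _ (nrm (a *: x + y) + re `|a| * nrm x + nrm y)) => e /uni1[n hn].
  have -> : Y (a *: x + y) - (a *: Y x + Y y) =
     (Y (a *: x + y) - Y_ n (a *: x + y)) + (- (a *: (Y x - Y_ n x)) + - (Y y - Y_ n y)).
    have [/(_ a x y) -> _] := sqrt_iter_bounded n.
    by apply: (dot_inj dot_norm) => u; rewrite !dotE; ring.
  apply: le_trans (nrmD _ _) _; rewrite -addrA mulrDl; apply: lerD.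
    by rewrite mulrC hn.
  apply: le_trans (nrmD _ _) _; rewrite mulrDl !nrmN nrmZ; apply: lerD.
    rewrite -mulrA ler_wpM2l ?[nrm x * _]mulrC //.
    by have := normr_ge0 a; rewrite cplx_le => /andP[].
  by rewrite mulrC.
exists Y; split=> //.
- apply: (csa_closed A_cstar) => // e /gt0_rc[-> /uni1[n hn]].
  exists (Y_ n); first exact: sqrt_iter_mem.
  by move=> x; rewrite !normHE -rcM ler_rc.
- move=> x y; apply/eqP; rewrite -subr_eq0 -normr_eq0 eq_le normr_ge0 andbT.
  rewrite normE -[0]rc0 ler_rc.
  apply: (@limit_le0 _ _ (4 * (nrm x * nrm y))) => e /uni1[n hn].
  rewrite -ler_rc -normE.
  have -> : dot (Y x) y - dot x (Y y) = dot (Y x - Y_ n x) y - dot x (Y y - Y_ n y).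
    by rewrite !dotE sqrt_iter_sym; ring.
  apply: le_trans (ler_normB _ _) _.
  apply: le_trans (lerD (dot_le dot_norm _ _) (dot_le dot_norm _ _)) _.
  rewrite -rcD ler_rc.
  have : nrm (Y x - Y_ n x) * nrm y <= e * nrm x * nrm y by rewrite ler_wpM2r ?nrm_ge0.
  have : nrm x * nrm (Y y - Y_ n y) <= nrm x * (e * nrm y) by rewrite ler_wpM2l ?nrm_ge0.
  by lra.
- move=> x; apply: (@vec_eq _ _ (4 * nrm x)) => e e0; have [N hN] := uni _ e0.
  pose n := N; have hn y : nrm (Y y - Y_ n y) <= e * nrm y by exact: hN.
  have hn1 : nrm (Y x - Y_ n.+1 x) <= e * nrm x by apply: hN.
  have -> : Y (Y x) - (Y x + Y x - S x) =
    (Y (Y x) - Y_ n (Y x)) + (Y_ n (Y x - Y_ n x) - rscale 2 (Y x - Y_ n.+1 x)).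
    have e1 : rscale 2 (Y_ n.+1 x) = S x + Y_ n (Y_ n x).
      by rewrite sqrt_iterS /rscale scalerA -rcM mulfV ?pnatr_eq0 // rc1 scale1r.
    rewrite (linear_opD (sqrt_iter_bounded n)) (linear_opN (sqrt_iter_bounded n)).
    have -> : rscale 2 (Y x - Y_ n.+1 x) = Y x + Y x - rscale 2 (Y_ n.+1 x).
      by rewrite /rscale scalerBr rcD rc1 scalerDl scale1r.
    by rewrite e1; apply: (dot_inj dot_norm) => u; rewrite !dotE; ring.
  have := nrmD (Y (Y x) - Y_ n (Y x)) (Y_ n (Y x - Y_ n x) - rscale 2 (Y x - Y_ n.+1 x)).
  have := nrmD (Y_ n (Y x - Y_ n x)) (- rscale 2 (Y x - Y_ n.+1 x)).
  rewrite nrmN nrmZr ger0_norm //.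
  have := sqrt_iter_le n (Y x - Y_ n x); have := hn x; have := hn (Y x).
  have h1 := Yle x; have : e * nrm (Y x) <= e * nrm x.
    rewrite ler_wpM2l ?(ltW e0) //; apply: le_trans h1 _.
    by rewrite ler_piMl ?nrm_ge0 // ltW.
  have : r * nrm (Y x - Y_ n x) <= 1 * nrm (Y x - Y_ n x).
    by rewrite ler_wpM2r ?nrm_ge0 // ltW.
  by lra.
Qed.
End Iteration.
End SquareRoot.

(** * States *)

Section States.
Variables (R : realType) (H : completeNormedModType (cplx R)).
Local Notation C := (cplx R).
Variable dot : {dot H for Num.conj}.
Hypothesis dot_norm : forall x : H, dot x x = `|x| ^+ 2.
Implicit Types (x y z v : H) (a : C) (s t e : R) (f g : H -> H).
Local Notation ip := (ip dot).

Section StateTheory.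
Variables (A : set (H -> H)) (phi : (H -> H) -> C).
Hypotheses (A_cstar : cstar_subalgebra dot A) (phi_state : state dot A phi).

Lemma state0 : phi 0 = 0.
Proof.
have A0 : A 0 by rewrite -(scale0r idfun); exact: (csa_scale A_cstar _ (csa_id A_cstar)).
have := state_linear phi_state 1 A0 A0.
rewrite scale1r mul1r addr0 => /eqP.
by rewrite -subr_eq0 opprD addrA subrr add0r oppr_eq0 => /eqP.
Qed.

Lemma stateD f g : A f -> A g -> phi (f + g) = phi f + phi g.
Proof. by move=> Af Ag; rewrite -[f in LHS]scale1r (state_linear phi_state) // mul1r. Qed.

Lemma stateZ a f : A f -> phi (a *: f) = a * phi f.
Proof.
move=> Af; have A0 : A 0.
  by rewrite -(scale0r idfun); exact: (csa_scale A_cstar _ (csa_id A_cstar)).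
by rewrite -[_ *: f]addr0 (state_linear phi_state) // state0 addr0.
Qed.

Lemma state_affine a b f : A f -> phi (a *: f + b *: idfun) = a * phi f + b.
Proof.
move=> Af; have Ai := csa_id A_cstar.
by rewrite stateD ?stateZ ?(state_id phi_state) ?mulr1 //; exact: (csa_scale A_cstar).
Qed.

Lemma adjoint_affine a b f : bounded_operator f ->
  adjoint dot (a *: f + b *: idfun) = a^* *: adjoint dot f + b^* *: idfun.
Proof.
move=> fb; apply: adjoint_unique => //.
  by apply: boundedD; apply: boundedZ => //; exact: bounded_id.
by move=> x y; rewrite !fctE !dotE !conjCK adjointP.
Qed.

(** Polarisation: phi ((f + a)^* (f + a)) is real for a = 1 and for a = i. *)
Lemma state_adjoint f : A f -> phi (adjoint dot f) = (phi f)^*.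
Proof.
move=> Af; have fb := csa_bounded A_cstar Af; have Aa := csa_adjoint A_cstar Af.
have Ai := csa_id A_cstar.
have key a : im (a * phi (adjoint dot f) + a^* * phi f) = 0.
  have Ag : A (1 *: f + a *: idfun).
    by apply: (csa_add A_cstar); apply: (csa_scale A_cstar).
  have := state_pos phi_state Ag; rewrite adjoint_affine //.
  have -> : (1^* *: adjoint dot f + a^* *: idfun) \o (1 *: f + a *: idfun) =
     (adjoint dot f \o f) + (a *: adjoint dot f + (a^* *: f + (a^* * a) *: idfun)).
    have ab := adjoint_bounded dot_norm fb.
    apply/funext => x /=; rewrite !fctE /= !scale1r conjC1 scale1r.
    rewrite (linear_opD ab) (linear_opZ ab) scalerDr scalerA.
    by rewrite !addrA.
  have A2 : A (adjoint dot f \o f) by exact: (csa_comp A_cstar).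
  have A3 : A (a *: adjoint dot f) by exact: (csa_scale A_cstar).
  have A4 : A (a^* *: f + (a^* * a) *: idfun).
    by apply: (csa_add A_cstar); apply: (csa_scale A_cstar).
  rewrite stateD //; last exact: (csa_add A_cstar).
  rewrite stateD // stateZ // state_affine // cplx_le => /andP[/eqP h _].
  have := state_pos phi_state Af; rewrite cplx_le => /andP[/eqP h2 _].
  by move: h; rewrite !cE in h2 *; rewrite h2; lra.
apply: cplx_eq; have := key 1; have := key (ci R); rewrite !cE; lra.
Qed.

Lemma affine_sym (a b : R) f : symmetric_op dot f ->
  symmetric_op dot (rc a *: f + rc b *: idfun).
Proof. by move=> fs x y; rewrite !fctE !dotE fs !conj_rc. Qed.

(** States are positive on elements f^* f only, so P has to be written as a
    square within A. For e > 0 the operator P + e is bounded below, hence a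
    multiple of it is 1 - S with |S| < 1 and has a square root in A. *)
Lemma state_positive_op P : A P -> symmetric_op dot P ->
  (forall x, 0 <= ip (P x) x) -> 0 <= re (phi P).
Proof.
move=> AP Ps P0; have Pb := csa_bounded A_cstar AP.
have [_ [M M0 hM]] := (boundedP P).1 Pb.
rewrite -oppr_le0; apply: (@limit_le0 _ _ 1) => e e0; rewrite mul1r.
(* S = 1 - (P + e) / m lies between 0 and M / m < 1. *)
pose m := M + e; have m0 : 0 < m by rewrite ltr_wpDl.
pose S := rc (- m^-1) *: P + rc (1 - e / m) *: idfun.
have Ai := csa_id A_cstar.
have AS : A S by apply: (csa_add A_cstar); apply: (csa_scale A_cstar).
have Sb := csa_bounded A_cstar AS.
have Ss : symmetric_op dot S by exact: affine_sym.
have ipP x : ip (P x) x <= M * ip x x by exact: ip_op_le.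
have ipS x : ip (S x) x = m^-1 * (M * ip x x - ip (P x) x).
  rewrite /S !fctE ipDl -!/(rscale _ _) !ipZl /m; field.
  by rewrite gt_eqF.
have r01 : 0 <= M / m < 1.
  by rewrite divr_ge0 ?(ltW m0) //= ltr_pdivrMr // mul1r ltrDl.
have S_form x : 0 <= ip (S x) x <= M / m * ip x x.
  rewrite ipS mulr_ge0 ?invr_ge0 ?(ltW m0) ?subr_ge0 //=.
  rewrite [M / m]mulrC -mulrA ler_wpM2l ?invr_ge0 ?(ltW m0) //.
  by rewrite gerBl.
have S_le x : nrm (S x) <= M / m * nrm x.
  have /andP[r0 _] := r01.
  rewrite -(@ler_pXn2r _ 2) // ?nnegrE ?nrm_ge0 ?(mulr_ge0 r0 (nrm_ge0 x)) //.
  apply: le_trans (positive_op_norm dot_norm Sb Ss S_form x) _.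
  rewrite exprMn (nrm_sqr dot_norm) expr2 -(mulrA (M / m) (M / m)) ler_wpM2l //.
  by have /andP[] := S_form x.
have [Y [AY Yb Ys Yeq]] := square_root dot_norm A_cstar AS Ss r01 S_le.
pose Q := rc (- 1) *: Y + rc 1 *: idfun.
have AQ : A Q by apply: (csa_add A_cstar); apply: (csa_scale A_cstar).
have := state_pos phi_state AQ.
rewrite (symmetric_adjoint dot_norm (csa_bounded A_cstar AQ)); last exact: affine_sym.
have -> : Q \o Q = rc m^-1 *: P + rc (e / m) *: idfun.
  apply/funext => x; apply: (dot_inj dot_norm) => z.
  rewrite /Q /= !fctE /= (linear_opD Yb) !(linear_opZ Yb) Yeq /S !fctE !dotE.
  rewrite !conj_rc; rewrite !(rcN, rcD, rc1); ring.
rewrite state_affine // cplx_le !cE !mul0r subr0 => /andP[_].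
have -> : m^-1 * re (phi P) + e / m = (re (phi P) + e) / m by field; rewrite gt_eqF.
by rewrite pmulr_lge0 ?invr_gt0 //; lra.
Qed.

End StateTheory.

Section VectorStates.
Variable T : H -> H.
Hypothesis T_bounded : bounded_operator T.

Lemma vector_state x : nrm x = 1 ->
  state dot (cstar_generated dot T) (fun f => dot (f x) x).
Proof.
move=> x1; split=> [a f g _ _|f hf|].
- by rewrite !fctE !dotE.
- have fb := csa_bounded (cstar_generated_cstar dot_norm T_bounded) hf.
  rewrite /= -(adjointPr dot_norm fb).
  by rewrite (dotxx dot_norm) -[0]rc0 ler_rc sqr_ge0.
- by rewrite (dotxx dot_norm) x1 expr1n.
Qed.

Lemma convex_state (A : set (H -> H)) phi psi t : 0 <= t <= 1 ->
  state dot A phi -> state dot A psi ->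
  state dot A (fun f => rc t * phi f + rc (1 - t) * psi f).
Proof.
move=> /andP[t0 t1] hp hq; split=> [a f g Af Ag|f Af|].
- by rewrite (state_linear hp) // (state_linear hq) //; ring.
- apply: addr_ge0; apply: mulr_ge0; rewrite ?(state_pos hp) ?(state_pos hq) //.
    by rewrite -[0]rc0 ler_rc.
  by rewrite -[0]rc0 ler_rc subr_ge0.
- by rewrite (state_id hp) (state_id hq) !mulr1 -rcD addrC subrK.
Qed.

End VectorStates.
End States.

(** * Plane sets with a flat boundary point *)

Section PlaneGeometry.
Variable R : realType.
Local Notation C := (cplx R).
Implicit Types (S : set C) (z u v : C) (s t e M : R).

(** Where [re z] is nonzero, the value +oo of the quotient does not occur. *)
Lemma quotient_bound S M : quotient_to_infty S ->
  exists2 d : R, 0 < d & forall z, S z -> re z != 0 -> `|re z| + `|im z| < d ->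
    M * re z ^+ 2 <= `|im z|.
Proof.
move=> /cvgeyPge/(_ M); rewrite near_withinE => /nbhs_ballP[e /gt0_rc[-> e0]] h.
exists (re e) => // z Sz z0 hz.
have z0' : z != 0 by apply: contra z0 => /eqP ->.
have zb : ball (0 : C) (rc (re e)) z.
  rewrite -ball_normE /= sub0r normrN.
  apply: le_lt_trans (norm_le (lexx _)) _; by rewrite ltr_rc.
have := h z zb z0' Sz; rewrite /curvature_quotient (negPf z0) lee_fin.
by rewrite ler_pdivlMr // exprn_even_gt0.
Qed.

Lemma closure0_small S : closure S 0 -> forall e, 0 < e ->
  exists2 z, S z & `|re z| <= e /\ `|im z| <= e.
Proof.
move=> cl e e0; have [|z [Sz]] := cl (ball (0 : C) (rc e)).
  by apply: nbhsx_ballx; rewrite -[0]rc0 ltr_rc.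
rewrite -ball_normE /= sub0r normrN => /ltW h.
by exists z => //; split; [exact: norm_re h|exact: norm_im h].
Qed.

(** Otherwise the line of direction 1 - i s would be a second supporting line. *)
Lemma unique_tangent_below S s : (forall L, supporting_line S 0 L -> L = @real_axis R) ->
  s != 0 -> exists2 z, S z & im z + s * re z < 0.
Proof.
move=> uni s0; apply: contrapT => none.
(* The line through v, a positive multiple of 1 - i s: im (z v^* ) is then the
   same multiple of im z + s re z. *)
pose n := Num.sqrt (1 + s ^+ 2).
have n2 : n ^+ 2 = 1 + s ^+ 2 by rewrite sqr_sqrtr // addr_ge0 // sqr_ge0.
have n0 : 0 < n by rewrite sqrtr_gt0 ltr_pwDl // sqr_ge0.
pose v : C := rc n^-1 * (1 - rc s * ci R).
have rv : re v = n^-1 by rewrite /v !cE; ring.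
have iv : im v = - s * n^-1 by rewrite /v !cE; ring.
have v1 : `|v| = 1.
  rewrite normE rv iv; have -> : n^-1 ^+ 2 + (- s * n^-1) ^+ 2 = 1.
    rewrite exprMn sqrrN -[X in X + _]mul1r -mulrDl -n2 -exprMn mulfV ?expr1n //.
    by rewrite gt_eqF.
  by rewrite sqrtr1.
clearbody v.
have sup : supporting_line S 0 [set 0 + rc t * v | t in [set: R]].
  exists v; split=> // z Sz; rewrite subr0.
  have -> : im (z * v^*) = n^-1 * (im z + s * re z) by rewrite !cE rv iv; ring.
  rewrite mulr_ge0 ?invr_ge0 ?(ltW n0) // leNgt; apply/negP => h.
  by apply: none; exists z.
have : @real_axis R v by rewrite -(uni _ sup); exists 1 => //; rewrite rc1 mul1r add0r.
rewrite /real_axis /= iv => /eqP; rewrite mulf_eq0 oppr_eq0 (negPf s0) invr_eq0.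
by rewrite gt_eqF.
Qed.

(** Let (a, b) in Q have small slope b / a but a >= e. Convexity gives points of
    Q close to (t a, t b) for a fixed small t; they are close to 0, and their
    second coordinate, of order t b, is below (t e / 2)^2 once b is small. *)
Lemma small_slope_small (Q : R -> R -> Prop) (d K : R) :
  (forall a b a' b' t, 0 <= t <= 1 -> Q a b -> Q a' b' ->
     Q (t * a + (1 - t) * a') (t * b + (1 - t) * b')) ->
  (forall a b, Q a b -> 0 <= b) ->
  (forall e, 0 < e -> exists a b, [/\ Q a b, `|a| <= e & b <= e]) ->
  0 < d -> (forall a b, Q a b -> 0 < a -> a + b < d -> a ^+ 2 <= b) ->
  0 <= K -> forall e, 0 < e -> exists2 s, 0 < s &
    forall a b, Q a b -> a <= K -> 0 < a -> b < s * a -> a < e.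
Proof.
move=> cvx pos near0 d0 curv K0 e e0.
have K1 : 0 < K + 1 by rewrite ltr_wpDl.
(* Small enough for t (a, b) to stay well inside the region where a^2 <= b. *)
pose t := Num.min 1 (d / (8 * (K + 1))).
have t0 : 0 < t by rewrite lt_min ltr01 divr_gt0 // mulr_gt0.
have t1 : t <= 1 by rewrite ge_min lexx.
have tK : t * K <= d / 8.
  apply: (@le_trans _ _ (d / (8 * (K + 1)) * (K + 1))).
    by apply: ler_pM; rewrite ?(ltW t0) ?lerDl // ge_min lexx orbT.
  by rewrite le_eqVlt; apply/orP; left; apply/eqP; field; rewrite gt_eqF.
(* Makes t b at most (t e)^2 / 8. *)
pose s := Num.min 1 (t * e ^+ 2 / (8 * (K + 1))).
have e2 : 0 < e ^+ 2 by rewrite exprn_gt0.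
have s0 : 0 < s by rewrite lt_min ltr01 divr_gt0 // mulr_gt0.
have sK : s * K <= t * e ^+ 2 / 8.
  apply: (@le_trans _ _ (t * e ^+ 2 / (8 * (K + 1)) * (K + 1))).
    by apply: ler_pM; rewrite ?(ltW s0) ?lerDl // ge_min lexx orbT.
  by rewrite le_eqVlt; apply/orP; left; apply/eqP; field; rewrite gt_eqF.
exists s => // a b Qab aK a0 bsa; rewrite ltNge; apply/negP => ea.
(* The error allowed in replacing 0 by a point of Q. *)
pose h := Num.min (t * e / 2) (Num.min (t ^+ 2 * e ^+ 2 / 16) (d / 8)).
have te0 : 0 < t * e by rewrite mulr_gt0.
have tt0 : 0 < t ^+ 2 * e ^+ 2 by rewrite mulr_gt0 // exprn_gt0.
have h0 : 0 < h by rewrite !lt_min !divr_gt0.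
have h1 : h <= t * e / 2 by rewrite ge_min lexx.
have h2 : h <= t ^+ 2 * e ^+ 2 / 16 by rewrite !ge_min lexx orbT.
have h3 : h <= d / 8 by rewrite !ge_min lexx !orbT.
have [a' [b' [Q' ha' hb']]] := near0 h h0.
have t01 : 0 <= t <= 1 by rewrite (ltW t0).
have := cvx _ _ _ _ _ t01 Qab Q'.
set wa := t * a + _; set wb := t * b + _ => Qw.
have ha1 : `|(1 - t) * a'| <= h.
  rewrite normrM ger0_norm ?subr_ge0 //; apply: le_trans ha'.
  by rewrite ler_piMl // gerBl ltW.
have hb1 : (1 - t) * b' <= h.
  apply: le_trans hb'; rewrite ler_piMl ?gerBl ?(ltW t0) //; exact: pos Q'.
have ta : t * e <= t * a by rewrite ler_wpM2l // ltW.
have tb : t * a <= t * K by rewrite ler_wpM2l // ltW.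
have bs : b <= s * K.
  by apply: le_trans (ltW bsa) _; rewrite ler_wpM2l // ltW.
have tb1 : t * b <= t * (t * e ^+ 2 / 8).
  by rewrite ler_wpM2l ?(ltW t0) //; apply: le_trans bs sK.
have bK : b <= K.
  apply: le_trans bs _; rewrite ler_piMl // ge_min lexx //.
have tb2 : t * b <= t * K by rewrite ler_wpM2l // ltW.
move: ha1; rewrite ler_norml => /andP[ha1 ha2].
have wa0 : t * e / 2 <= wa by rewrite /wa; lra.
have := curv _ _ Qw; have : (t * e / 2) ^+ 2 <= wa ^+ 2.
  by rewrite ler_pXn2r // ?nnegrE; lra.
have wa1 : 0 < wa by lra.
have wab : wa + wb < d by rewrite /wa /wb; lra.
move=> sq /(_ wa1 wab) sq2.
have wb1 : wb <= t * (t * e ^+ 2 / 8) + t ^+ 2 * e ^+ 2 / 16 by rewrite /wb; lra.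
have e3 : (t * e / 2) ^+ 2 = t ^+ 2 * e ^+ 2 / 4 by field.
have e4 : t * (t * e ^+ 2 / 8) = t ^+ 2 * e ^+ 2 / 8 by field.
by rewrite e3 in sq; rewrite e4 in wb1; lra.
Qed.

End PlaneGeometry.

(** * Quadratic forms and curvature *)

Section Operators.
Variables (R : realType) (H : completeNormedModType (cplx R)).
Local Notation C := (cplx R).
Variable dot : {dot H for Num.conj}.
Hypothesis dot_norm : forall x : H, dot x x = `|x| ^+ 2.
Implicit Types (x y z v : H) (a : C) (s t e : R) (f g : H -> H).
Local Notation ip := (ip dot).

(** The choices a = 1/2 and a = -i/2 give the real and the imaginary part of f. *)
Definition twice_real_part a f : H -> H := a *: f + a^* *: adjoint dot f.

Section RealPart.
Variables (f : H -> H) (f_bounded : bounded_operator f).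

Lemma twice_real_part_bounded a : bounded_operator (twice_real_part a f).
Proof. by apply: boundedD; apply: boundedZ => //; exact: adjoint_bounded. Qed.

Lemma twice_real_part_sym a : symmetric_op dot (twice_real_part a f).
Proof.
move=> x y; rewrite /twice_real_part !fctE !dotE conjCK -(adjointP dot_norm f_bounded).
by rewrite (adjointPr dot_norm f_bounded) addrC.
Qed.

Lemma twice_real_part_ip a x : ip (twice_real_part a f x) x = 2 * re (a * dot (f x) x).
Proof.
rewrite [LHS](_ : _ = re (dot (twice_real_part a f x) x)) // /twice_real_part !fctE !dotE.
rewrite -(adjointPr dot_norm f_bounded) [dot x (f x)]dotC.
by rewrite !cE; ring.
Qed.

Lemma state_twice_real_part A phi a : cstar_subalgebra dot A -> state dot A phi -> A f ->
  phi (twice_real_part a f) = rc (2 * re (a * phi f)).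
Proof.
move=> cA sp Af; rewrite (stateD sp); last 2 first.
- exact: (csa_scale cA).
- by apply: (csa_scale cA); exact: (csa_adjoint cA).
rewrite !(stateZ cA sp) ?(state_adjoint dot_norm cA sp) //; last exact: (csa_adjoint cA).
by apply: cplx_eq; rewrite !cE; ring.
Qed.

End RealPart.

Lemma ip_scale f t x : bounded_operator f ->
  ip (f (rscale t x)) (rscale t x) = t ^+ 2 * ip (f x) x.
Proof. by move=> fb; rewrite /rscale linear_opZ // -!/(rscale _ _) ipZl ipZr; ring. Qed.

Lemma nrm_normalize x : x != 0 -> nrm (rscale (nrm x)^-1 x) = 1.
Proof.
move=> x0; have n0 : nrm x != 0 by apply: contra x0 => /eqP/nrm0P ->.
by rewrite nrmZr ger0_norm ?invr_ge0 ?nrm_ge0 // mulVf.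
Qed.

(** Here A and B are the real and imaginary parts of an operator. If A x were
    not small, then at z = x + t A x the form of A would exceed t |A x|^2,
    whereas that of B, being nonnegative and nearly 0 at x, is only of order t^2;
    for t small this contradicts infinite curvature, the hypothesis on M and d. *)
Lemma curvature_forces_small (A B : H -> H) (c : R) :
  bounded_operator A -> bounded_operator B -> symmetric_op dot A ->
  (forall x, 0 <= ip (B x) x) -> 0 < c ->
  (forall x, nrm (A x) <= c * nrm x) -> (forall x, nrm (B x) <= c * nrm x) ->
  (forall M, exists2 d, 0 < d & forall x, nrm x = 1 -> 0 < ip (A x) x ->
     ip (A x) x + ip (B x) x < d -> M * ip (A x) x ^+ 2 <= ip (B x) x) ->
  forall e, 0 < e -> exists2 d, 0 < d & forall x, nrm x = 1 ->
     `|ip (A x) x| <= d -> ip (B x) x <= d -> ip (A x) (A x) < e.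
Proof.
move=> Ab Bb As B0 c0 Ac Bc curv e e0.
(* The estimates below give q N <= 12 t^2 c G and p >= t G for the forms p, q at z
   and N = |z|^2, while G >= e; with M = 13 c / e, M p^2 <= q N is impossible. *)
have [d1 d10 hom] := curv (13 * c / e).
pose t := Num.min (1 / (2 * c)) (d1 / (4 * (6 * c ^+ 2))).
have c2 : 0 < c ^+ 2 by rewrite exprn_gt0.
have cc : 0 < 6 * c ^+ 2 by lra.
have t0 : 0 < t by rewrite lt_min !divr_gt0 // mulr_gt0.
have tc : t * c <= 1 / 2.
  apply: (@le_trans _ _ (1 / (2 * c) * c)).
    by rewrite ler_wpM2r ?(ltW c0) // ge_min lexx.
  by rewrite le_eqVlt; apply/orP; left; apply/eqP; field; rewrite gt_eqF.
have td : t * (6 * c ^+ 2) <= d1 / 4.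
  apply: (@le_trans _ _ (d1 / (4 * (6 * c ^+ 2)) * (6 * c ^+ 2))).
    by rewrite ler_wpM2r ?(ltW cc) // ge_min lexx orbT.
  by rewrite le_eqVlt; apply/orP; left; apply/eqP; field; rewrite gt_eqF.
have te0 : 0 < t * e by rewrite mulr_gt0.
have tte0 : 0 < t ^+ 2 * c * e by rewrite !mulr_gt0 // exprn_gt0.
exists (Num.min (t * e / 2) (t ^+ 2 * c * e / 2)).
  by rewrite lt_min !divr_gt0.
move=> x x1; rewrite !le_min => /andP[a1 a2] /andP[b1 b2].
rewrite ltNge; apply/negP => eG; set G := ip (A x) (A x) in eG.
set a := ip (A x) x in a1 a2; set b := ip (B x) x in b1 b2.
have b0 : 0 <= b by exact: B0.
have G0 : 0 < G by apply: lt_le_trans eG.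
have Gc : G <= c ^+ 2.
  rewrite /G -(nrm_sqr dot_norm) ler_pXn2r ?nnegrE ?nrm_ge0 ?(ltW c0) //.
  by have := Ac x; rewrite x1 mulr1.
have nA : nrm (A x) <= c by have := Ac x; rewrite x1 mulr1.
pose z := x + rscale t (A x).
have form_bound f : (forall x, nrm (f x) <= c * nrm x) -> `|ip (f (A x)) (A x)| <= c * G.
  move=> fc; apply: le_trans (ip_le dot_norm _ _) _.
  by rewrite /G -(nrm_sqr dot_norm) expr2 mulrA; apply: ler_wpM2r; rewrite ?nrm_ge0.
have zA : ip (A z) z = a + 2 * t * G + t ^+ 2 * ip (A (A x)) (A x).
  rewrite /z (linear_opD Ab) /rscale (linear_opZ Ab) -!/(rscale _ _) !ipE.
  by rewrite (symmetric_ip (A x) x As) -/G -/a; ring.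
(* The parallelogram law for the form of B, whose value at x - t A x is >= 0. *)
have zB : ip (B z) z <= 2 * b + 2 * t ^+ 2 * ip (B (A x)) (A x).
  have := B0 (x - rscale t (A x)).
  rewrite /z !(linear_opD Bb) (linear_opN Bb) /rscale (linear_opZ Bb) -!/(rscale _ _) !ipE.
  by rewrite -/b; lra.
have ztA := form_bound A Ac; have ztB := form_bound B Bc.
have tG0 : 0 < t * G by rewrite mulr_gt0.
have teG : t * e <= t * G by rewrite ler_wpM2l // ltW.
have tcG : t * c * (t * G) <= 1 / 2 * (t * G) by rewrite ler_wpM2r // ltW.
have tceG : t ^+ 2 * c * e <= t ^+ 2 * c * G.
  by rewrite ler_wpM2l // ltW // !mulr_gt0 // exprn_gt0.
have t20 : 0 < t ^+ 2 by rewrite exprn_gt0.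
have tA : `|t ^+ 2 * ip (A (A x)) (A x)| <= 1 / 2 * (t * G).
  rewrite normrM (ger0_norm (ltW t20)); apply: le_trans tcG.
  apply: (@le_trans _ _ (t ^+ 2 * (c * G))); first by rewrite ler_wpM2l // ltW.
  by rewrite le_eqVlt; apply/orP; left; apply/eqP; ring.
have tB : t ^+ 2 * ip (B (A x)) (A x) <= t ^+ 2 * c * G.
  rewrite -mulrA ler_wpM2l ?(ltW t20) //; exact: le_trans (ler_norm _) ztB.
have zB2 : ip (B z) z <= 3 * (t ^+ 2 * c * G) by lra.
move: tA; rewrite ler_norml => /andP[tA1 tA2].
move: (a1); rewrite ler_norml => /andP[a3 a4].
have zA1 : t * G <= ip (A z) z by rewrite zA; lra.
have zA2 : ip (A z) z <= 4 * (t * G) by rewrite zA; lra.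
have tn : `|t| * nrm (A x) <= 1 / 2.
  rewrite (ger0_norm (ltW t0)); apply: le_trans tc.
  by rewrite ler_wpM2l // ltW.
have z1 : 1 / 2 <= nrm z.
  have := nrmD z (- rscale t (A x)); rewrite nrmN nrmZr /z addrK x1; lra.
have z2 : nrm z <= 2.
  by apply: le_trans (nrmD _ _) _; rewrite nrmZr x1; lra.
have nz : nrm z != 0 by rewrite gt_eqF //; lra.
have z0 : z != 0 by apply: contra nz => /eqP ->; rewrite nrm0.
have zz1 : 1 / 4 <= nrm z ^+ 2.
  have -> : 1 / 4 = (1 / 2) ^+ 2 :> R by field.
  by rewrite ler_pXn2r // ?nnegrE; lra.
have zz2 : nrm z ^+ 2 <= 4.
  have -> : 4 = 2 ^+ 2 :> R by ring.
  by rewrite ler_pXn2r // ?nnegrE; lra.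
have zz0 : 0 < nrm z ^+ 2 by lra.
have := hom _ (nrm_normalize z0).
rewrite !ip_scale // exprVn.
set p := ip (A z) z in zA zA1 zA2 *; set q := ip (B z) z in zB zB2 *.
set N := nrm z ^+ 2 in zz0 zz1 zz2 *.
have p0 : 0 < p by lra.
have -> : N^-1 * p + N^-1 * q = (p + q) / N by field; rewrite gt_eqF.
rewrite ltr_pdivrMr // => /(_ (mulr_gt0 _ p0)).
have -> : 13 * c / e * (N^-1 * p) ^+ 2 = 13 * c / e * p ^+ 2 / N * N^-1.
  by field; rewrite !gt_eqF.
rewrite invr_gt0 => /(_ zz0).
have small : p + q < d1 * N.
  have tGc : t * G <= t * c ^+ 2 by rewrite ler_wpM2l // ltW.
  have tGc2 : t ^+ 2 * c * G <= 1 / 2 * (t * c ^+ 2).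
    have -> : t ^+ 2 * c * G = t * c * (t * G) by ring.
    by apply: ler_pM; rewrite ?mulr_ge0 ?(ltW t0) ?(ltW c0) ?(ltW G0).
  have : d1 * (1 / 4) <= d1 * N by rewrite ler_wpM2l // ltW.
  have : 0 < t * c ^+ 2 by rewrite mulr_gt0.
  by lra.
move=> /(_ small); rewrite [N^-1 * q]mulrC.
rewrite ler_pM2r ?invr_gt0 // ler_pdivrMr //.
have sq : (t * G) ^+ 2 <= p ^+ 2 by rewrite ler_pXn2r // ?nnegrE; lra.
have qN : q * N <= 3 * (t ^+ 2 * c * G) * 4.
  by apply: ler_pM => //; [exact: B0|exact: ltW].
have : 13 * c / e * (t * G) ^+ 2 <= 13 * c / e * p ^+ 2.
  by rewrite ler_wpM2l // divr_ge0 ?(ltW e0) // mulr_ge0 // ltW.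
have : 13 * (t ^+ 2 * c * G) <= 13 * c / e * (t * G) ^+ 2.
  have -> : 13 * c / e * (t * G) ^+ 2 = 13 * (t ^+ 2 * c * G) * (G / e).
    by field; rewrite gt_eqF.
  rewrite ler_peMr ?ler_pdivlMr ?mul1r // mulr_ge0 // ltW //.
  by rewrite !mulr_gt0.
have : 0 < t ^+ 2 * c * G by rewrite !mulr_gt0.
by lra.
Qed.

End Operators.

(** * Weakly null sequences *)

Section WeaklyNull.
Variables (R : realType) (H : completeNormedModType (cplx R)).
Local Notation C := (cplx R).
Variable dot : {dot H for Num.conj}.
Hypothesis dot_norm : forall x : H, dot x x = `|x| ^+ 2.
Implicit Types (x y z v : H) (a : C) (s t e : R) (f g : H -> H).
Local Notation ip := (ip dot).

Section RangeVectors.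
Variables A B : H -> H.
Hypotheses (Ab : bounded_operator A) (Bb : bounded_operator B).
Hypotheses (As : symmetric_op dot A) (Bs : symmetric_op dot B).

Definition in_range_closure x :=
  forall e, 0 < e -> exists y z, nrm (x - (A y + B z)) <= e.

(** The vectors orthogonal to the ranges of the symmetric operators A and B are
    those annihilated by both; removing that component of x changes neither A x
    nor B x. *)
Lemma range_projection x : exists p, [/\ in_range_closure p,
  (forall y z, dot (x - p) (A y + B z) = 0), A p = A x & B p = B x].
Proof.
pose V := [set v | exists y z, v = A y + B z].
have [||a v|p [cl orth]] := projection dot_norm (V := V) _ _ _ x.
- by exists 0, 0; rewrite (linear_op0 Ab) (linear_op0 Bb) addr0.
- move=> _ _ [y [z ->]] [y' [z' ->]]; exists (y + y'), (z + z').
  by rewrite (linear_opD Ab) (linear_opD Bb) addrACA.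
- by move=> [y [z ->]]; exists (a *: y), (a *: z);
  rewrite (linear_opZ Ab) (linear_opZ Bb) scalerDr.
have orth' y z : dot (x - p) (A y + B z) = 0 by apply: orth; exists y, z.
exists p; split=> //.
- by move=> e /cl[_ [y [z ->]] h]; exists y, z.
- apply/esym/eqP; rewrite -subr_eq0 -(linear_opN Ab) -(linear_opD Ab).
  apply/eqP/(dot_eq0 dot_norm) => y; rewrite -As dotC.
  by have := orth' y 0; rewrite (linear_op0 Bb) addr0 => ->; rewrite conjC0.
- apply/esym/eqP; rewrite -subr_eq0 -(linear_opN Bb) -(linear_opD Bb).
  apply/eqP/(dot_eq0 dot_norm) => z; rewrite -Bs dotC.
  by have := orth' 0 z; rewrite (linear_op0 Ab) add0r => ->; rewrite conjC0.
Qed.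

Lemma in_range_closureZ t x : in_range_closure x -> in_range_closure (rscale t x).
Proof.
move=> cl e e0; have t0 : 0 < `|t| + 1 by rewrite ltr_wpDl.
have [|y [z h]] := cl (e / (`|t| + 1)); first by rewrite divr_gt0.
exists (rscale t y), (rscale t z).
rewrite /rscale (linear_opZ Ab) (linear_opZ Bb) -scalerDr -scalerBr -/(rscale _ _) nrmZr.
apply: (@le_trans _ _ ((`|t| + 1) * (e / (`|t| + 1)))).
  by apply: ler_pM; rewrite ?nrm_ge0 // lerDl.
by rewrite mulrC divfK // gt_eqF.
Qed.

(** Against A v + B w the inner products tend to 0 by symmetry; these vectors
    approximate every y up to a component orthogonal to all the u n. *)
Lemma weakly_null (u : nat -> H) : (forall n, in_range_closure (u n)) ->
  (forall n, nrm (u n) = 1) -> (forall n, nrm (A (u n)) <= n.+1%:R^-1) ->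
  (forall n, nrm (B (u n)) <= n.+1%:R^-1) -> weakly_to_zero dot u.
Proof.
move=> ucl u1 uA uB y; apply/cvg0P => e e0.
have [p [pcl porth _ _]] := range_projection y.
have orth n : dot (u n) (y - p) = 0.
  apply/eqP; rewrite -normr_eq0 eq_le normr_ge0 andbT normE -[0]rc0 ler_rc.
  apply: (@limit_le0 _ _ (2 * nrm (y - p))) => d /(ucl n)[v [w h]].
  rewrite -ler_rc -normE.
  have -> : dot (u n) (y - p) = dot (u n - (A v + B w)) (y - p).
    by rewrite [in RHS]dotDl dotNl [dot (A v + B w) _]dotC porth conjC0 subr0.
  apply: le_trans (dot_le dot_norm _ _) _; rewrite ler_rc -mulrA ler_wpM2l //.
  by rewrite mulrC ler_wpM2l ?nrm_ge0.
have [|v [w h]] := pcl (e / 4); first by rewrite divr_gt0.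
pose K := nrm v + nrm w; have K0 : 0 <= K by rewrite addr_ge0 ?nrm_ge0.
have [|N hN] := inv_small (e := e / (4 * (K + 1))).
  by rewrite divr_gt0 // mulr_gt0 // ltr_wpDl.
exists N => n /hN {}hN.
have -> : dot (u n) y = dot (u n) (p - (A v + B w)) + (dot (A (u n)) v + dot (B (u n)) w).
  have := orth n; rewrite As Bs !dotE => /eqP; rewrite subr_eq0 => /eqP ->; ring.
have le1 : n.+1%:R^-1 * K <= e / 4.
  apply: (@le_trans _ _ (e / (4 * (K + 1)) * (K + 1))).
    by apply: ler_pM; rewrite ?invr_ge0 // lerDl.
  by rewrite le_eqVlt; apply/orP; left; apply/eqP; field; rewrite gt_eqF // ltr_wpDl.
apply: le_trans (ler_normD _ _) _.
apply: le_trans (lerD (dot_le dot_norm _ _) (ler_normD _ _)) _.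
apply: le_trans (lerD (lexx _) (lerD (dot_le dot_norm _ _) (dot_le dot_norm _ _))) _.
rewrite -!rcD ler_rc u1 mul1r.
have : nrm (A (u n)) * nrm v <= n.+1%:R^-1 * nrm v by rewrite ler_wpM2r ?nrm_ge0.
have : nrm (B (u n)) * nrm w <= n.+1%:R^-1 * nrm w by rewrite ler_wpM2r ?nrm_ge0.
by rewrite /K in le1; move: h le1; move: (n.+1%:R^-1) => d; lra.
Qed.

(** A vector x at which the slope of the forms is below s need not lie in the
    closure of the ranges, but its projection does and has the same forms. Once
    that is normalised, the last hypothesis makes the form of A small, hence that
    of B, and curvature turns small forms into small vectors. *)
Lemma small_range_vectors (c : R) : (forall x, 0 <= ip (B x) x) -> 0 < c ->
  (forall x, nrm (A x) <= c * nrm x) -> (forall x, nrm (B x) <= c * nrm x) ->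
  (forall M, exists2 d, 0 < d & forall x, nrm x = 1 -> 0 < ip (A x) x ->
     ip (A x) x + ip (B x) x < d -> M * ip (A x) x ^+ 2 <= ip (B x) x) ->
  (forall s, 0 < s -> exists x, ip (B x) x < s * ip (A x) x) ->
  (forall e, 0 < e -> exists2 s, 0 < s & forall x, nrm x = 1 -> 0 < ip (A x) x ->
     ip (B x) x < s * ip (A x) x -> ip (A x) x < e) ->
  forall e, 0 < e -> exists x,
    [/\ nrm x = 1, in_range_closure x, nrm (A x) <= e & nrm (B x) <= e].
Proof.
move=> B0 c0 Ac Bc curv below slope e e0.
have e2 : 0 < e ^+ 2 by rewrite exprn_gt0.
have [d d0 hd] := curvature_forces_small dot_norm Ab Bb As B0 c0 Ac Bc curv e2.
have [|s s0 hs] := slope (Num.min d (e ^+ 2 / c)).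
  by rewrite lt_min d0 divr_gt0.
have m0 : 0 < Num.min s 1 by rewrite lt_min s0 ltr01.
have [x hx] := below _ m0.
have [p [pcl _ pA pB]] := range_projection x.
have ipA : ip (A p) p = ip (A x) x.
  by rewrite pA (symmetric_ip _ _ As) pA -(symmetric_ip _ _ As).
have ipB : ip (B p) p = ip (B x) x.
  by rewrite pB (symmetric_ip _ _ Bs) pB -(symmetric_ip _ _ Bs).
rewrite -ipA -ipB in hx.
have Ap0 : 0 < ip (A p) p.
  by have := le_lt_trans (B0 p) hx; rewrite pmulr_rgt0.
have p0 : p != 0.
  by apply: contraTneq Ap0 => ->; rewrite ip0r ltxx.
have n0 : 0 < nrm p.
  by rewrite lt_neqAle nrm_ge0 andbT eq_sym; apply: contra p0 => /eqP/nrm0P ->.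
pose q := rscale (nrm p)^-1 p; have q1 : nrm q = 1 by exact: nrm_normalize.
have i0 : 0 < (nrm p)^-1 ^+ 2 by rewrite exprn_gt0 // invr_gt0.
have Aq0 : 0 < ip (A q) q by rewrite ip_scale // mulr_gt0.
have hq : ip (B q) q < Num.min s 1 * ip (A q) q.
  by rewrite !ip_scale // mulrCA ltr_pM2l.
have hq1 : ip (B q) q < ip (A q) q.
  by apply: lt_le_trans hq _; rewrite ler_piMl ?(ltW Aq0) // ge_min lexx orbT.
have hqs : ip (B q) q < s * ip (A q) q.
  by apply: lt_le_trans hq _; rewrite ler_wpM2r ?(ltW Aq0) // ge_min lexx.
have := hs _ q1 Aq0 hqs; rewrite lt_min => /andP[ad ac].
exists q; split=> //; first exact: in_range_closureZ.
  rewrite -(@ler_pXn2r _ 2) // ?nnegrE ?nrm_ge0 ?(ltW e0) // (nrm_sqr dot_norm).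
  apply/ltW/hd => //; first by rewrite ger0_norm ltW.
  exact: ltW (lt_trans hq1 ad).
rewrite -(@ler_pXn2r _ 2) // ?nnegrE ?nrm_ge0 ?(ltW e0) //.
have Bform w : 0 <= ip (B w) w <= c * ip w w by rewrite B0 ip_op_le.
apply: le_trans (positive_op_norm dot_norm Bb Bs Bform _) _.
by rewrite -ler_pdivlMl // mulrC; exact: ltW (lt_trans hq1 ac).
Qed.

End RangeVectors.

(** * The operator in standard position *)

Section Placement.
Variables (T : H -> H) (lambda u : C).
Hypotheses (T_bounded : bounded_operator T) (u1 : `|u| = 1).
Local Notation W := (state_numerical_range dot T).
Local Notation W' := (place W lambda u).
Local Notation cT := (cstar_generated_cstar dot_norm T_bounded).

(** u (T - lambda), whose values under states are the points of W'. *)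
Definition placed : H -> H := u *: T + (- (u * lambda)) *: idfun.
Local Notation S := placed.

(** The sign [sg] is 1 or -1 according to the side of infinite curvature, which is
    thus always the side where the form of [Apart sg] is positive. *)
Definition Apart (sg : R) := twice_real_part dot (rc (sg / 2)) S.
Definition Bpart := twice_real_part dot (rc (- 2^-1) * ci R) S.

Lemma placed_mem : cstar_generated dot T S.
Proof.
apply: (csa_add cT); apply: (csa_scale cT); last exact: (csa_id cT).
exact: cstar_generated_sub.
Qed.

Lemma placed_bounded : bounded_operator S.
Proof. exact: (csa_bounded cT placed_mem). Qed.

Lemma placed_state phi : state dot (cstar_generated dot T) phi -> W' (phi S).
Proof.
move=> hp; exists (phi T); first by exists phi.
by rewrite (state_affine cT hp) ?mulrBr //; exact: cstar_generated_sub.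
Qed.

Lemma placedP (z : C) : W' z ->
  exists2 phi, state dot (cstar_generated dot T) phi & z = phi S.
Proof.
move=> [_ [phi hp <-] <-]; exists phi => //.
by rewrite (state_affine cT hp) ?mulrBr //; exact: cstar_generated_sub.
Qed.

Lemma placed_vector x : nrm x = 1 -> W' (dot (S x) x).
Proof. by move=> /(vector_state dot_norm T_bounded)/placed_state. Qed.

Lemma placed_convex (z w : C) t : 0 <= t <= 1 -> W' z -> W' w ->
  W' (rc t * z + rc (1 - t) * w).
Proof.
move=> t01 /placedP[phi hp ->] /placedP[psi hq ->].
exact: (placed_state (convex_state t01 hp hq)).
Qed.

Lemma nrm_unimodular a x : `|a| = 1 -> nrm (a *: x) = nrm x.
Proof. by move=> a1; rewrite nrmZ a1 mul1r. Qed.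

Lemma placed_nrm x : nrm (S x) = nrm (T x - lambda *: x).
Proof.
have -> : S x = u *: (T x - lambda *: x).
  by rewrite /S !fctE scalerBr scalerA scaleNr.
exact: nrm_unimodular.
Qed.

Lemma placed_adjoint_nrm x :
  nrm (adjoint dot S x) = nrm (adjoint dot T x - lambda^* *: x).
Proof.
have -> : adjoint dot S x = u^* *: (adjoint dot T x - lambda^* *: x).
  by rewrite (adjoint_affine dot_norm) // !fctE scalerBr scalerA rmorphN rmorphM scaleNr.
by apply: nrm_unimodular; rewrite norm_conjC.
Qed.

Lemma Apart_ip sg x : ip (Apart sg x) x = sg * re (dot (S x) x).
Proof. by rewrite (twice_real_part_ip dot_norm placed_bounded) !cE; field. Qed.

Lemma Bpart_ip x : ip (Bpart x) x = im (dot (S x) x).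
Proof. by rewrite (twice_real_part_ip dot_norm placed_bounded) !cE; field. Qed.

Lemma placed_decomp sg x : sg ^+ 2 = 1 ->
  S x = rc sg *: Apart sg x + ci R *: Bpart x /\
  adjoint dot S x = rc sg *: Apart sg x - ci R *: Bpart x.
Proof.
move=> sg2; rewrite /Apart /Bpart /twice_real_part !fctE !scalerDr !scalerA.
have -> : rc sg * rc (sg / 2) = rc 2^-1 by rewrite -rcM mulrA -expr2 sg2 mul1r.
have -> : rc sg * (rc (sg / 2))^* = rc 2^-1.
  by rewrite conj_rc -rcM mulrA -expr2 sg2 mul1r.
have -> : ci R * (rc (- 2^-1) * ci R) = rc 2^-1 by apply: cplx_eq; rewrite !cE; ring.
have -> : ci R * (rc (- 2^-1) * ci R)^* = - rc 2^-1 by apply: cplx_eq; rewrite !cE; ring.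
have h2 y : y = rc 2^-1 *: y + rc 2^-1 *: y.
  by rewrite -scalerDl -rcD -{1}[y]scale1r; congr (_ *: y); rewrite -rc1; congr rc; field.
split; [rewrite {1}[S x]h2|rewrite {1}[adjoint _ _ x]h2];
  by apply: (dot_inj dot_norm) => z; rewrite !dotE; ring.
Qed.

Lemma Bpart_ge0 : (forall z : C, W' z -> 0 <= im z) -> forall x, 0 <= ip (Bpart x) x.
Proof.
move=> pos x; have [->|x0] := eqVneq x 0; first by rewrite ip0r.
have := pos _ (placed_vector (nrm_normalize x0)).
rewrite -Bpart_ip ip_scale ?pmulr_rge0 // ?exprn_gt0 ?invr_gt0 //.
  by rewrite lt_neqAle nrm_ge0 andbT eq_sym; apply: contra x0 => /eqP/nrm0P ->.
exact: (twice_real_part_bounded dot_norm placed_bounded).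
Qed.

(** Positivity of states turns an inequality between forms into one on W'. *)
Lemma state_tilt sg s phi : state dot (cstar_generated dot T) phi ->
  (forall x, s * ip (Apart sg x) x <= ip (Bpart x) x) ->
  s * sg * re (phi S) <= im (phi S).
Proof.
move=> hp le; pose a : C := rc (- 2^-1) * ci R - rc (s * sg / 2).
have re_a (w : C) : 2 * re (a * w) = im w - s * sg * re w by rewrite !cE; field.
have mem : cstar_generated dot T (twice_real_part dot a S).
  apply: (csa_add cT); apply: (csa_scale cT); first exact: placed_mem.
  exact: (csa_adjoint cT placed_mem).
have := state_positive_op dot_norm cT hp mem
  (twice_real_part_sym dot_norm placed_bounded a).
rewrite (state_twice_real_part dot_norm a cT hp placed_mem) re_rc re_a subr_ge0.
apply => x; rewrite (twice_real_part_ip dot_norm placed_bounded) re_a subr_ge0.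
by have := le x; rewrite Apart_ip Bpart_ip mulrA.
Qed.

(** For s > 0 the line im z = s sg re z does not support W', which therefore has
    points below it on the side of infinite curvature; by [state_tilt] some vector
    has a value there. As s tends to 0 the real parts of such values tend to 0 by
    [small_slope_small], so that [small_range_vectors] applies. *)
Lemma reducing_of_one_sided sg : sg ^+ 2 = 1 ->
  standard_position W' -> (forall L, supporting_line W' 0 L <-> L = @real_axis R) ->
  quotient_to_infty (W' `&` [set z : C | 0 < sg * re z]) ->
  reducing_essential_eigenvalue dot T lambda.
Proof.
move=> sg2 [[cl0 _] pos] tang quot.
have sg0 : sg != 0 by apply: contra_eq_neq sg2 => ->; rewrite expr0n eq_sym oner_eq0.
have nsg : `|sg| = 1.
  by apply/eqP; rewrite -(@eqrXn2 _ 2) // real_normK ?num_real // sg2 expr1n.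
pose A := Apart sg; pose B := Bpart.
have Ab : bounded_operator A by exact: (twice_real_part_bounded dot_norm placed_bounded).
have Bb : bounded_operator B by exact: (twice_real_part_bounded dot_norm placed_bounded).
have As : symmetric_op dot A by exact: (twice_real_part_sym dot_norm placed_bounded).
have Bs : symmetric_op dot B by exact: (twice_real_part_sym dot_norm placed_bounded).
have B0 := Bpart_ge0 pos.
have [c [c0 Ac Bc]] : exists c, [/\ 0 < c, forall x, nrm (A x) <= c * nrm x &
    forall x, nrm (B x) <= c * nrm x].
  have [_ [c1 c10 h1]] := (boundedP A).1 Ab; have [_ [c2 c20 h2]] := (boundedP B).1 Bb.
  exists (c1 + c2 + 1); split=> [|x|x]; first by rewrite ltr_wpDl // addr_ge0.
    by apply: le_trans (h1 x) _; rewrite ler_wpM2r ?nrm_ge0 //; lra.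
  by apply: le_trans (h2 x) _; rewrite ler_wpM2r ?nrm_ge0 //; lra.
have curvW M : exists2 d, 0 < d & forall z : C, W' z -> 0 < sg * re z ->
    sg * re z + im z < d -> M * (sg * re z) ^+ 2 <= im z.
  have [d d0 hd] := quotient_bound M quot; exists d => // z Wz rz hz.
  have im0 := pos _ Wz.
  have rz0 : re z != 0 by apply: contraTneq rz => ->; rewrite mulr0 ltxx.
  have := hd z (conj Wz rz) rz0; rewrite exprMn sg2 mul1r (ger0_norm im0).
  by apply; rewrite -[`|re z|]mul1r -nsg -normrM gtr0_norm.
have curv M : exists2 d, 0 < d & forall x, nrm x = 1 -> 0 < ip (A x) x ->
    ip (A x) x + ip (B x) x < d -> M * ip (A x) x ^+ 2 <= ip (B x) x.
  have [d d0 hd] := curvW M; exists d => // x x1.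
  by rewrite Apart_ip Bpart_ip => h1 h2; apply: hd => //; exact: placed_vector.
have below s : 0 < s -> exists x, ip (B x) x < s * ip (A x) x.
  move=> s0; apply: contrapT => none.
  have [|z /placedP[phi hp ->]] :=
    @unique_tangent_below _ W' (- (s * sg)) (fun L => (tang L).1).
    by rewrite oppr_eq0 mulf_neq0 // gt_eqF.
  rewrite mulNr subr_lt0 ltNge => /negP; apply; apply: state_tilt => // x.
  by rewrite leNgt; apply/negP => h; apply: none; exists x.
have slope e : 0 < e -> exists2 s, 0 < s & forall x, nrm x = 1 -> 0 < ip (A x) x ->
    ip (B x) x < s * ip (A x) x -> ip (A x) x < e.
  pose Q (a b : R) := exists2 z, W' z & a = sg * re z /\ b = im z.
  have [d d0 hd] := curvW 1.
  move=> e0; have [|a b|d' d'0|a b|s s0 hs] :=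
    @small_slope_small _ Q d c _ _ _ d0 _ (ltW c0) e e0.
  - move=> a b a' b' t t01 [z Wz [-> ->]] [w Ww [-> ->]].
    by exists (rc t * z + rc (1 - t) * w); [exact: placed_convex|rewrite !cE; split; ring].
  - by move=> [z Wz [_ ->]]; exact: pos.
  - have [z Wz [h1 h2]] := closure0_small cl0 d'0.
    exists (sg * re z), (im z); split; first by exists z.
      by rewrite normrM nsg mul1r.
    exact: le_trans (ler_norm _) h2.
  - move=> [z Wz [-> ->]] h1 h2; rewrite -[X in X <= _]mul1r; exact: hd.
  exists s => // x x1 h1 h2; apply: (hs _ (ip (B x) x)) => //.
    by exists (dot (S x) x); [exact: placed_vector|rewrite Apart_ip Bpart_ip].
  apply: le_trans (ler_norm _) _; apply: le_trans (ip_le dot_norm _ _) _.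
  by have := Ac x; rewrite x1 !mulr1.
have ex n : exists x, [/\ nrm x = 1, in_range_closure A B x,
    nrm (A x) <= n.+1%:R^-1 & nrm (B x) <= n.+1%:R^-1].
  apply: (small_range_vectors Ab Bb As Bs B0 c0 Ac Bc curv below slope).
  by rewrite invr_gt0.
have [v hv] := choice ex; exists v; split.
- by move=> n; have [h _ _ _] := hv n; rewrite normHE h.
- by apply: (weakly_null Ab Bb As Bs) => n; have [] := hv n.
apply/cvg0P => e e0; have [|N hN] := inv_small (e := e / 4); first by rewrite divr_gt0.
exists N => n /hN; have [_ _] := hv n; move: (n.+1%:R^-1) => d hA hB hd.
rewrite !normHE -rcD -placed_nrm -placed_adjoint_nrm norm_rc ler_rc.
rewrite ger0_norm ?addr_ge0 ?nrm_ge0 //.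
have [-> ->] := placed_decomp (v n) sg2.
have := nrmD (rc sg *: A (v n)) (ci R *: B (v n)).
have := nrmD (rc sg *: A (v n)) (- (ci R *: B (v n))).
rewrite nrmN nrm_ci -/(rscale _ _) nrmZr nsg mul1r -/A -/B; lra.
Qed.

(** The imaginary part B of the placed operator S is positive, so |B x|^2 is
    dominated by (B x, x) <= |S x|, and S^* = S - 2 i B. *)
Lemma approximate_eigenvector_normal : (forall z : C, W' z -> 0 <= im z) ->
  forall v : nat -> H, orthonormal_sequence dot v ->
  `|T (v n) - lambda *: v n| @[n --> \oo] --> (0 : C) ->
  `|adjoint dot T (v n) - lambda^* *: v n| @[n --> \oo] --> (0 : C).
Proof.
move=> pos v on /cvg0P small; apply/cvg0P => e e0.
have B0 := Bpart_ge0 pos.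
have Bb : bounded_operator Bpart.
  by exact: (twice_real_part_bounded dot_norm placed_bounded).
have Bs : symmetric_op dot Bpart by exact: (twice_real_part_sym dot_norm placed_bounded).
have [_ [c c0 Bc]] := (boundedP Bpart).1 Bb.
have Bform x : 0 <= ip (Bpart x) x <= c * ip x x by rewrite B0 ip_op_le.
have c1 : 0 < c + 1 by rewrite ltr_wpDl.
pose d := Num.min (e / 2) ((e / 4) ^+ 2 / (c + 1)).
have d0 : 0 < d by rewrite lt_min !divr_gt0 // exprn_gt0 // divr_gt0.
have [N hN] := small d d0; exists N => n /hN.
rewrite !normHE !norm_rc !ler_rc !ger0_norm ?nrm_ge0 //.
rewrite -placed_nrm -placed_adjoint_nrm; set x := v n.
have x1 : nrm x = 1.
  have := on n n; rewrite eqxx (dotxx dot_norm) => /(congr1 (@re R)).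
  rewrite re_rc re1 => /eqP; rewrite sqrf_eq1 => /orP[/eqP //|/eqP h].
  by have := nrm_ge0 x; rewrite h; lra.
rewrite le_min => /andP[h1 h2].
have hB : nrm (Bpart x) <= e / 4.
  rewrite -(@ler_pXn2r _ 2) // ?nnegrE ?nrm_ge0 ?divr_ge0 ?(ltW e0) //.
  apply: le_trans (positive_op_norm dot_norm Bb Bs Bform _) _.
  have ipS : ip (Bpart x) x <= nrm (placed x).
    rewrite Bpart_ip im_dot; apply: le_trans (ler_norm _) _.
    by apply: le_trans (ip_le dot_norm _ _) _; rewrite nrm_ci x1 mulr1.
  apply: (@le_trans _ _ ((c + 1) * nrm (placed x))).
    by apply: ler_pM; rewrite ?B0 // lerDl.
  by rewrite -ler_pdivlMl // mulrC.
have [eS eSs] := placed_decomp x (expr1n R 2).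
have -> : adjoint dot placed x = placed x - rscale 2 (ci R *: Bpart x).
  rewrite eSs eS /rscale scalerA; apply: (dot_inj dot_norm) => z.
  rewrite !dotE rmorphM /= conj_rc (rcD 1 1) rc1; ring.
apply: le_trans (nrmD _ _) _; rewrite nrmN nrmZr nrm_ci ger0_norm //; lra.
Qed.

End Placement.

End WeaklyNull.

Theorem corollary9 (R : realType) (H : completeNormedModType (cplx R))
    (dot : {dot H for Num.conj}) (dot_norm : forall x : H, dot x x = `|x| ^+ 2)
    (T : H -> H) (T_bounded : bounded_operator T) (lambda : cplx R) :
  interior (state_numerical_range dot T) !=set0 ->
  infinite_one_sided_curvature (state_numerical_range dot T) lambda ->
  (exists! L, supporting_line (state_numerical_range dot T) lambda L) ->
  reducing_essential_eigenvalue dot T lambda /\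
  (infinite_curvature (state_numerical_range dot T) lambda ->
   normal_essential_eigenvalue dot T lambda).
Proof.
move=> _ [u [u1 std tang onesided]] _.
have re_ev : reducing_essential_eigenvalue dot T lambda.
  case: onesided => [left|right].
    apply: (reducing_of_one_sided dot_norm T_bounded u1 (sg := -1)) => //.
      by rewrite sqrrN expr1n.
    suff -> : [set z : cplx R | 0 < -1 * re z] = [set z | re z < 0] by [].
    by apply/seteqP; split=> z /=; rewrite mulN1r oppr_gt0.
  apply: (reducing_of_one_sided dot_norm T_bounded u1 (sg := 1)) => //.
    by rewrite expr1n.
  suff -> : [set z : cplx R | 0 < 1 * re z] = [set z | 0 < re z] by [].
  by apply/seteqP; split=> z /=; rewrite mul1r.
split=> // _; split=> // v.
by apply: (approximate_eigenvector_normal dot_norm T_bounded u1); case: std.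
Qed.
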